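(* Let $\mathrm{Sh}$ be a Haar shift of complexity $(t,s)$ on $\mathbb{R}^d$ and let $f\in L^1(\mathbb{R}^d)$. Then there exist $r>0$ and a sparse family $\mathcal{S}\subset\mathscr{D}$ such that $$|\mathrm{Sh}^*f(x)|\lesssim_{s,t}\sum_{Q\in\mathcal{S}}\mathsf{P}^r_Q(\mathcal{M}_Qf)\,\mathbf{1}_Q(x),\qquad x\in\mathbb{R}^d.$$
   Context: $\mathscr{D}=\bigcup_k\mathscr{D}_k$ is the standard dyadic grid on $\mathbb{R}^d$ ($\mathscr{D}_k$ of side $2^{-k}$), $\mathscr{D}(Q)$ the dyadic subcubes of $Q$, $\mathscr{D}_\ell(Q)$ those of side length $2^{-\ell}\ell(Q)$, $\langle f\rangle_Q=\frac1{|Q|}\int_Qf$. $\{h_Q\}$ is a fixed Haar basis of $L^2(\mathbb{R}^d)$ (each $h_Q$ supported on $Q$, constant on the children of $Q$, mean zero, $L^2$-normalized). $\mathrm{Sh}f=\sum_{Q\in\mathscr{D}}\sum_{T\in\mathscr{D}_t(Q)}\sum_{S\in\mathscr{D}_s(Q)}\alpha^Q_{TS}\langle f,h_T\rangle h_S$ with $\sup|\alpha^Q_{TS}|<\infty$, and $\mathrm{Sh}^*f(x)=\sup_{\ell<m}|\sum_{k=\ell}^m\sum_{x\in Q\in\mathscr{D}_k}\sum_{T\in\mathscr{D}_t(Q)}\sum_{S\in\mathscr{D}_s(Q)}\alpha^Q_{TS}\langle f,h_T\rangle h_S(x)|$. $\mathcal{M}_Qf(x)=\sup_{x\in R\in\mathscr{D}(Q)}|\langle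 f\rangle_R|$. $\mathsf{P}^r_Q(g):=\inf\{\lambda\in\mathbb{R}:|\{x\in Q:g(x)>\lambda\}|\le r|Q|\}$. A family $\mathcal{S}\subset\mathscr{D}$ is sparse if for each $Q\in\mathcal{S}$, $|Q\setminus\bigcup_{R\in\mathcal{S},R\subsetneq Q}R|\ge\frac12|Q|$. *)

(* Defs.v *)
From HB Require Import structures.
From mathcomp Require Import all_boot all_order all_algebra.
From mathcomp Require Import all_classical all_reals all_analysis.
Unset Printing Implicit Defensive.
Import Order.TTheory GRing.Theory Num.Theory.
Local Open Scope classical_set_scope.
Local Open Scope ring_scope.

(* Points of R^d are d-tuples of reals (with the product = Borel sigma-algebra
   provided by mathcomp-analysis on tuples). *)

(* Lebesgue measure on R^d, defined by iterated (Tonelli) integration: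
   |A| = \int |{t : x :: t \in A}|_{d-1} dx, with the Dirac mass on R^0. *)
Fixpoint leb {R : realType} (n : nat) : set (n.-tuple R) -> \bar R :=
  match n return set (n.-tuple R) -> \bar R with
  | 0 => fun A => if `[< A [tuple] >] then 1%E else 0%E
  | n'.+1 => fun A =>
      (\int[@lebesgue_measure R]_x
         @leb R n' [set t : n'.-tuple R | A (cons_tuple (x : R) t)])%E
  end.

(* Dyadic cubes: (k, j) stands for prod_i [j_i 2^-k, (j_i + 1) 2^-k). *)
Definition dcube (d : nat) := (int * d.-tuple int)%type.

Definition dside (R : realType) {d : nat} (Q : dcube d) : R := (2 : R) ^ (- Q.1).

Definition dset (R : realType) {d : nat} (Q : dcube d) : set (d.-tuple R) :=
  [set x | forall i : 'I_d,
     (tnth Q.2 i)%:~R * dside R Q <= tnth x i /\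
     tnth x i < ((tnth Q.2 i)%:~R + 1) * dside R Q].

Definition vol (R : realType) {d : nat} (Q : dcube d) : \bar R := leb d (dset R Q).

Definition Dsub (R : realType) {d : nat} (Q : dcube d) : set (dcube d) :=
  [set P | dset R P `<=` dset R Q].
Definition Dl (R : realType) {d : nat} (Q : dcube d) (l : nat) : set (dcube d) :=
  [set P | P.1 = Q.1 + l%:Z /\ dset R P `<=` dset R Q].

Definition pairing {R : realType} {d : nat} (f g : d.-tuple R -> R) : R :=
  fine (\int[leb d]_x (f x * g x)%:E)%E.

Definition avg {R : realType} {d : nat} (f : d.-tuple R -> R) (Q : dcube d) : R :=
  fine (\int[leb d]_(x in dset R Q) (f x)%:E)%E / fine (vol R Q).

(* Haar system: on each dyadic cube Q there are 2^d - 1 Haar functions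
   h Q e, each supported on Q, constant on the children of Q, with mean zero,
   and orthonormal in L^2 (so they form an orthonormal basis of the mean-zero
   functions constant on the children of Q; together they form a Haar basis
   of L^2(R^d)). *)
Definition haar_basis {R : realType} {d : nat}
    (h : dcube d -> 'I_(2 ^ d).-1 -> d.-tuple R -> R) : Prop :=
  forall (Q : dcube d) (e : 'I_(2 ^ d).-1),
    [/\ (forall x, ~ dset R Q x -> h Q e x = 0),
        (forall P, Dl R Q 1 P -> exists c : R, forall x, dset R P x -> h Q e x = c),
        (\int[leb d]_x (h Q e x)%:E = 0)%E
      & (forall e' : 'I_(2 ^ d).-1,
           (\int[leb d]_x (h Q e x * h Q e' x)%:E = ((e == e')%:R)%:E)%E)].

Definition shift_trunc {R : realType} {d : nat} (s t : nat)
    (h : dcube d -> 'I_(2 ^ d).-1 -> d.-tuple R -> R)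
    (alpha : dcube d -> dcube d -> dcube d -> 'I_(2 ^ d).-1 -> 'I_(2 ^ d).-1 -> R)
    (f : d.-tuple R -> R) (l m : int) (x : d.-tuple R) : R :=
  \sum_(k \in [set k : int | l <= k <= m])
   \sum_(Q \in [set Q : dcube d | Q.1 = k /\ dset R Q x])
    \sum_(T \in Dl R Q t)
     \sum_(S \in Dl R Q s)
      \sum_(e < (2 ^ d).-1) \sum_(e' < (2 ^ d).-1)
        alpha Q T S e e' * pairing f (h T e) * h S e' x.

Definition shift_max {R : realType} {d : nat} (s t : nat)
    (h : dcube d -> 'I_(2 ^ d).-1 -> d.-tuple R -> R)
    (alpha : dcube d -> dcube d -> dcube d -> 'I_(2 ^ d).-1 -> 'I_(2 ^ d).-1 -> R)
    (f : d.-tuple R -> R) (x : d.-tuple R) : \bar R :=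
  ereal_sup [set y : \bar R | exists l m : int,
     l < m /\ y = (`| shift_trunc s t h alpha f l m x |)%:E].

Definition MQ {R : realType} {d : nat} (f : d.-tuple R -> R) (Q : dcube d)
    (x : d.-tuple R) : \bar R :=
  ereal_sup [set (`| avg f P |)%:E | P in [set P | Dsub R Q P /\ dset R P x]].

Definition Pq {R : realType} {d : nat} (r : R) (Q : dcube d)
    (g : d.-tuple R -> \bar R) : \bar R :=
  ereal_inf [set lam%:E | lam in
    [set lam : R | (leb d (dset R Q `&` [set x | (lam%:E < g x)%E])
                     <= r%:E * vol R Q)%E]].

Definition sparse (R : realType) {d : nat} (S : set (dcube d)) : Prop :=
  forall Q, S Q ->
    ((2^-1 : R)%:E * vol R Q <=
       leb d (dset R Q `\` \bigcup_(P in [set P | S P /\ dset R P `<` dset R Q])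
                              dset R P))%E.

(* Main.v *)
(* Fix a cube Q, let lam be the quantile P^r_Q(M_Q f) with r comparable to
   2^(-d(t+2)), and stop at the maximal subcubes P of Q for which either some
   subcube t+1 generations below P has average larger than lam in absolute
   value, or the partial sum of the shift started at Q exceeds K A lam on P.
   Cubes of the first kind cover at most 2^(d(t+1)) r |Q|, because each contains
   a comparable part of {M_Q f > lam}.  Above them every average entering the
   shift is at most lam, so the partial sums, stopped there, form a martingale
   whose quadratic variation telescopes to O(A^2 lam^2 |Q|); Kolmogorov's maximal
   inequality then makes the cubes of the second kind cover a small part of Q.
   No weak-type bound for the shift is needed.  Between Q and the next stopping
   cube the partial sums are O(A lam), and one iterates.  The iteration starts
   from the cubes of even generation with a vertex at the origin, which are also
   forced to be stopping cubes: every point lies in arbitrarily large ones, and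
   each of them fills only a fraction 4^(-d) of the next, which keeps the family
   sparse. *)

Require Import Defs.
From HB Require Import structures.
From mathcomp Require Import all_boot all_order all_algebra.
From mathcomp Require Import ring lra zify.
From mathcomp Require Import all_classical all_reals all_analysis.
Set Implicit Arguments.
Unset Strict Implicit.
Unset Printing Implicit Defensive.
Import Order.TTheory GRing.Theory Num.Theory.
Local Open Scope classical_set_scope.
Local Open Scope ring_scope.

(** * Averages, hitting fractions and stopped martingales on a regular tree *)

(* A node of the tree is a word whose head is the deepest choice: the ancestors of
   [w] are the [drop i w]. *)
Definition child_mean {K : numFieldType} {O : finType} (F : seq O -> K) (w : seq O) : K :=
  #|O|%:R^-1 * \sum_(o : O) F (o :: w).

(* The fraction of the node [w] covered by nodes satisfying [c] among its
   descendants of relative depth at most [n]. *)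
Fixpoint hit {K : numFieldType} {O : finType} (c : pred (seq O)) (n : nat) (w : seq O) : K :=
  if c w then 1 else if n is n'.+1 then child_mean (hit c n') w else 0.

(* No ancestor of [w], itself included, satisfies [c]. *)
Fixpoint alive {O : finType} (c : pred (seq O)) (w : seq O) : bool :=
  ~~ c w && (if w is _ :: w' then alive c w' else true).

Section ChildMean.
Variables (K : realFieldType) (O : finType) (o0 : O).
Implicit Types (F G : seq O -> K) (c : pred (seq O)) (w u v : seq O).

Lemma card_inv_gt0 : 0 < #|O|%:R^-1 :> K.
Proof. by rewrite invr_gt0 ltr0n; apply/card_gt0P; exists o0. Qed.

Lemma cardr_neq0 : #|O|%:R != 0 :> K.
Proof. by rewrite pnatr_eq0 -lt0n; apply/card_gt0P; exists o0. Qed.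

Lemma ler_child_mean F G w :
  (forall o, F (o :: w) <= G (o :: w)) -> child_mean F w <= child_mean G w.
Proof.
move=> FG; rewrite /child_mean ler_wpM2l ?(ltW card_inv_gt0)//.
by apply: ler_sum => o _.
Qed.

Lemma eq_child_mean F G w :
  (forall o, F (o :: w) = G (o :: w)) -> child_mean F w = child_mean G w.
Proof. by move=> FG; rewrite /child_mean; congr (_ * _); apply: eq_bigr. Qed.

Lemma child_mean_const F (k : K) w :
  (forall o, F (o :: w) = k) -> child_mean F w = k.
Proof.
move=> Fk; rewrite /child_mean (eq_bigr (fun=> k)) ?sumr_const; last by move=> o _.
by rewrite -[k *+ _]mulr_natl mulKf// cardr_neq0.
Qed.

Lemma child_meanD F G w :
  child_mean (fun x => F x + G x) w = child_mean F w + child_mean G w.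
Proof. by rewrite /child_mean big_split mulrDr. Qed.

Lemma child_meanZ (k : K) F w : child_mean (fun x => k * F x) w = k * child_mean F w.
Proof. by rewrite /child_mean -mulr_sumr mulrCA. Qed.

Lemma child_mean_sum n (F : nat -> seq O -> K) w :
  child_mean (fun x => \sum_(i < n) F i x) w = \sum_(i < n) child_mean (F i) w.
Proof. by rewrite /child_mean exchange_big -mulr_sumr. Qed.

Lemma ler_iter_mean n F G u :
  (forall w, size w = (n + size u)%N -> F w <= G w) ->
  iter n child_mean F u <= iter n child_mean G u.
Proof.
elim: n u => [u H|n IHn u H]; first exact: H.
by apply: ler_child_mean => o; apply: IHn => w sw; apply: H; rewrite sw addnS.
Qed.

Lemma iter_meanZ n (k : K) F u :
  iter n child_mean (fun x => k * F x) u = k * iter n child_mean F u.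
Proof.
elim: n u => // n IHn u.
by rewrite !iterS -child_meanZ; apply: eq_child_mean => o; rewrite IHn.
Qed.

Lemma iter_mean_const n (k : K) u : iter n child_mean (fun=> k) u = k.
Proof. by elim: n u => // n IHn u; rewrite iterS; apply: child_mean_const. Qed.

Lemma iter_mean_ge0 n F u :
  (forall w, 0 <= F w) -> 0 <= iter n child_mean F u.
Proof.
by move=> F0; rewrite -[leLHS](iter_mean_const n 0 u); apply: ler_iter_mean => w _.
Qed.

Lemma eq_iter_mean n F G u : F =1 G -> iter n child_mean F u = iter n child_mean G u.
Proof.
by move=> FG; apply/eqP; rewrite eq_le; apply/andP; split; apply: ler_iter_mean => w _; rewrite FG.
Qed.

Lemma iter_mean_drop n F u : iter n child_mean (fun w => F (drop n w)) u = F u.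
Proof.
elim: n F u => [F u|n IHn F u]; first by rewrite /= drop0.
rewrite iterS; apply: child_mean_const => o.
rewrite (@eq_iter_mean n _ (fun w => F (drop 1 (drop n w)))).
  by rewrite (IHn (fun w => F (drop 1 w))) /= drop0.
by move=> w; rewrite drop_drop add1n.
Qed.

Lemma iter_mean_words n F u :
  iter n child_mean F u = (#|O|%:R^-1) ^+ n * \sum_(v : n.-tuple O) F (v ++ u).
Proof.
elim: n u => [u|n IHn u].
  rewrite /= expr0 mul1r (bigD1 [tuple])//= big1 ?addr0// => v.
  by case/eqP; rewrite [v]tuple0.
rewrite iterS /child_mean (eq_bigr _ (fun o _ => IHn (o :: u))) -mulr_sumr mulrA -exprS.
congr (_ * _).
rewrite (pair_big xpredT xpredT (fun o (v : n.-tuple O) => F (v ++ o :: u)))/=.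
(* The outermost mean chooses the letter next to [u], which is the last letter of the word: hence
   [rcons]. *)
pose g (p : O * n.-tuple O) : n.+1.-tuple O := [tuple of rcons p.2 p.1].
have g_bij : bijective g.
  apply: inj_card_bij => [[ o v] [ o' v'] /(congr1 val)/= /rcons_inj[/val_inj-> ->]//|].
  by rewrite card_prod !card_tuple expnS.
rewrite (reindex g (onW_bij _ g_bij)) /=.
by apply: eq_bigr => -[ o v] _ /=; rewrite cat_rcons.
Qed.

Lemma hit_ge0 c n w : 0 <= hit c n w :> K.
Proof.
elim: n w => [w|n IHn w] /=; case: ifP => // _.
by rewrite -[leLHS](@child_mean_const (fun=> 0) 0 w)//; apply: ler_child_mean.
Qed.

Lemma hit_le1 c n w : hit c n w <= 1 :> K.
Proof.
elim: n w => [w|n IHn w] /=; case: ifP => // _.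
by rewrite -[leRHS](@child_mean_const (fun=> 1) 1 w)//; apply: ler_child_mean.
Qed.

Lemma hit_or c1 c2 n w : hit (fun x => c1 x || c2 x) n w <= hit c1 n w + hit c2 n w :> K.
Proof.
elim: n w => [w|n IHn w] /=; rewrite /in_mem/=.
  by case: (c1 w); case: (c2 w) => //=; lra.
have H0 c : 0 <= child_mean (hit c n) w :> K.
  rewrite -[leLHS](@child_mean_const (fun=> 0) 0 w)//; apply: ler_child_mean => o.
  exact: hit_ge0.
case: (c1 w); case: (c2 w) => //=; rewrite ?lerDl ?lerDr ?ler01//.
by rewrite -child_meanD; exact: ler_child_mean.
Qed.

(** A node [size v] levels below [u] fills this fraction of [u], and an earlier hit on the way only
    raises it. The induction peels off the letter next to [u], the last one of [v]. *)
Lemma hit_word c n v u : (size v <= n)%N -> c (v ++ u) ->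
  #|O|%:R^-1 ^+ size v <= hit c n u :> K.
Proof.
have le1 k : #|O|%:R^-1 ^+ k <= 1 :> K.
  rewrite exprn_ile1 ?(ltW card_inv_gt0)// invf_le1.
    by rewrite ler1n; apply/card_gt0P; exists o0.
  by rewrite -invr_gt0 card_inv_gt0.
elim/last_ind: v n u => [n u _ /=|v o IHv n u].
  by case: n => [|n] /= ->.
rewrite size_rcons cat_rcons; case: n => // n; rewrite ltnS => vn cv /=.
case: ifP => // _; rewrite exprS /child_mean ler_wpM2l ?(ltW card_inv_gt0)//.
apply: (le_trans (IHv n (o :: u) vn cv)).
by rewrite (bigD1 o)//= lerDl sumr_ge0// => o' _; exact: hit_ge0.
Qed.

(** Doob's maximal inequality for a nonnegative martingale: at a hit [F] is at least [k], elsewhere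
    [F] is the mean of its values on the children. *)
Lemma hit_markov (F : seq O -> K) (k : K) c n u : 0 <= k ->
  (forall w, 0 <= F w) -> (forall w, child_mean F w = F w) ->
  (forall w, c w -> k <= F w) -> k * hit c n u <= F u.
Proof.
move=> k0 F0 Fm ck; elim: n u => [|n IHn] u /=; case: ifPn => cu.
- by rewrite mulr1 ck.
- by rewrite mulr0.
- by rewrite mulr1 ck.
- by rewrite -child_meanZ -[leRHS]Fm; exact: ler_child_mean.
Qed.

Lemma child_mean_hit_le c n u : child_mean (hit c n) u <= hit c n.+1 u :> K.
Proof.
rewrite /=; case: ifP => // _.
by rewrite -[leRHS](@child_mean_const (fun=> 1) 1 u)//; apply: ler_child_mean => o; exact: hit_le1.
Qed.

Lemma hit0 c n u : (forall w, ~~ c w) -> hit c n u = 0 :> K.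
Proof.
move=> c0; elim: n u => [|n IHn] u /=; rewrite (negbTE (c0 _))//.
exact: child_mean_const.
Qed.

Lemma iter_meanD n F G u :
  iter n child_mean (fun x => F x + G x) u = iter n child_mean F u + iter n child_mean G u.
Proof.
elim: n u => // n IHn u.
by rewrite !iterS -child_meanD; apply: eq_child_mean => o; rewrite IHn.
Qed.

Lemma iter_mean_le_bound n F (k : K) u :
  (forall v : n.-tuple O, F (v ++ u) <= k) -> iter n child_mean F u <= k.
Proof.
move=> Fk; rewrite iter_mean_words.
rewrite -[leRHS](iter_mean_const n k [::]) iter_mean_words ler_wpM2l//.
by apply: ler_sum => v _.
Qed.

Lemma alive_catr c v u : alive c (v ++ u) -> alive c u.
Proof. by elim: v => //= o v IHv /andP[_]. Qed.

Lemma alive_drop c n u : alive c u -> alive c (drop n u).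
Proof. by rewrite -{1}(cat_take_drop n u); exact: alive_catr. Qed.

Lemma aliveW c u : alive c u -> ~~ c u.
Proof. by case: u => [|o u] /= /andP[]. Qed.

Lemma aliveP c u : reflect (forall v w, u = v ++ w -> ~~ c w) (alive c u).
Proof.
apply: (iffP idP) => [+ v w uE|]; first by rewrite uE => /alive_catr /aliveW.
elim: u => [H|o u IHu H] /=; rewrite (H [::] _ erefl)//.
by apply: IHu => v w uE; apply: (H (o :: v)); rewrite uE.
Qed.

(** Kolmogorov's maximal inequality for the martingale [N] with increments [d]. At a hit [N ^+ 2]
    exceeds [k ^+ 2]; elsewhere orthogonality ([NE]) moves one level down, and the first term of the
    quadratic variation pays for it. *)
Lemma hit_kolmogorov (N d : seq O -> K) (k : K) n u : 0 <= k ->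
  (forall o w, N (o :: w) = N w + d (o :: w)) -> (forall w, child_mean d w = 0) ->
  k ^+ 2 * hit (fun w => k < `|N w|) n u <=
    N u ^+ 2 + \sum_(j < n) iter j child_mean (child_mean (fun w => d w ^+ 2)) u.
Proof.
move=> k0 Nd d0.
have d2_ge0 j w : 0 <= iter j child_mean (child_mean (fun w => d w ^+ 2)) w.
  by rewrite -iterSr; apply: iter_mean_ge0 => w'; rewrite sqr_ge0.
have NE w : child_mean (fun w => N w ^+ 2) w = N w ^+ 2 + child_mean (fun w => d w ^+ 2) w.
  rewrite (@eq_child_mean _ (fun x => (N w ^+ 2 + (2 * N w) * d x) + d x ^+ 2)); last first.
    by move=> o; rewrite Nd; ring.
  rewrite 2!child_meanD child_meanZ d0 mulr0 addr0; congr (_ + _).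
  exact: child_mean_const.
have kN w : k < `|N w| -> k ^+ 2 <= N w ^+ 2.
  by move=> kN; rewrite -[N w ^+ 2]real_normK ?num_real// ler_pXn2r ?nnegrE// ltW.
elim: n u => [|n IHn] u; rewrite /hit -/hit; case: ifP => [/kN kNu|_].
- by rewrite mulr1 big_ord0 addr0.
- by rewrite mulr0 addr_ge0 ?sqr_ge0 ?sumr_ge0.
- by rewrite mulr1 (le_trans kNu)// lerDl sumr_ge0.
rewrite -child_meanZ big_ord_recl addrA -NE -child_mean_sum -child_meanD.
by apply: ler_child_mean => o; exact: IHn.
Qed.

End ChildMean.

(** * Stopping rules and stopped sums on the tree *)

Definition spread {K : numDomainType} {O : finType} (t : nat) (a : seq O -> K) (lam : K)
    (w : seq O) : bool :=
  [exists v : t.+1.-tuple O, lam < `|a (v ++ w)|].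

(* [D w] is the part of the shift coming from the ancestor [s.+1] levels above [w];
   whether it is kept is already decided at depth [size w - s.+1], hence the
   martingale property. *)
Fixpoint stopped_sum {V : nmodType} {O : finType} (c : pred (seq O)) (s : nat)
    (D : seq O -> V) (w : seq O) : V :=
  if w is _ :: w' then
    stopped_sum c s D w' + (if (s <= size w')%N && alive c (drop s w') then D w else 0)
  else 0.

(** The sum is stopped by the first condition alone, so the energy estimate does not involve [k]. *)
Definition stop {K : numDomainType} {O : finType} (s t : nat) (a D : seq O -> K)
    (lam k : K) : pred (seq O) :=
  fun w => spread t a lam w || (k < `|stopped_sum (spread t a lam) s D w|).

Section TreeShift.
Variables (K : realFieldType) (O : finType) (o0 : O) (s t : nat).
Variables (a D : seq O -> K) (lam A C0 : K).
Hypotheses (lam_ge0 : 0 <= lam) (A_ge0 : 0 <= A) (C0_ge1 : 1 <= C0).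
Hypothesis a_mean : forall w, child_mean a w = a w.
Hypothesis D_mean : forall w, (s <= size w)%N -> child_mean D w = 0.
(** As [a] is a martingale, this is the variance of its values on the children of [w]. *)
Let var w := child_mean (fun w => a w ^+ 2) w - a w ^+ 2.
Hypothesis D_bound : forall v u, size v = s.+1 ->
  D (v ++ u) ^+ 2 <= C0 * A ^+ 2 * iter t child_mean var u.

Let b : K := #|O|%:R.
Let c := spread t a lam.
Let phi := iter t child_mean (fun w => a w ^+ 2).
Let psi u := if alive c u then iter t child_mean var u else 0.
Let d (w : seq O) := if w is _ :: w' then
  (if (s <= size w')%N && alive c (drop s w') then D w else 0) else 0.

Let b_gt0 : 0 < b. Proof. by rewrite -invr_gt0 card_inv_gt0. Qed.

(** A node satisfying [c] has a node with large [a] exactly [t.+1] levels below, which fills the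
    fraction [b ^- t.+1] of it. *)
Lemma hit_spread n u :
  hit c n u <= b ^+ t.+1 * hit (fun w => lam < `|a w|) (n + t.+1) u.
Proof.
elim: n u => [|n IHn] u; rewrite [leLHS]/=; case: ifP => [/existsP[v lv]|cu].
- by rewrite -ler_pdivrMl ?exprn_gt0// mulr1 -exprVn -{1}(size_tuple v) hit_word// size_tuple.
- by rewrite mulr_ge0 ?exprn_ge0 ?(ltW b_gt0)// hit_ge0.
- rewrite -ler_pdivrMl ?exprn_gt0// mulr1 -exprVn -{1}(size_tuple v) hit_word//.
  by rewrite size_tuple leq_addl.
apply: (@le_trans _ _ (b ^+ t.+1 * child_mean (hit (fun w => lam < `|a w|) (n + t.+1)) u)).
  by rewrite -child_meanZ; exact: ler_child_mean.
rewrite ler_wpM2l ?exprn_ge0 ?(ltW b_gt0)//.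
exact: child_mean_hit_le.
Qed.

Lemma iter_mean_var u : iter t child_mean var u =
  iter t.+1 child_mean (fun w => a w ^+ 2) u - phi u.
Proof.
rewrite /var iter_meanD iterSr; congr (_ + _).
rewrite (@eq_iter_mean _ _ o0 _ _ (fun w => -1 * a w ^+ 2)).
  by rewrite iter_meanZ mulN1r.
by move=> w; rewrite mulN1r.
Qed.

Lemma sqr_le_lam v u : ~~ c u -> size v = t.+1 -> a (v ++ u) ^+ 2 <= lam ^+ 2.
Proof.
move=> /existsPn cu vt; have vt' : size v == t.+1 by apply/eqP.
have := cu (Tuple vt'); rewrite /= -leNgt => alam.
by rewrite -[a _ ^+ 2]real_normK ?num_real// ler_pXn2r ?nnegrE.
Qed.

(** The values of [a] entering [phi (o :: u)] sit [t.+1] levels below [u], within the reach of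
    [c u]. *)
Lemma phi_le_lam o u : ~~ c u -> phi (o :: u) <= lam ^+ 2.
Proof.
move=> cu; apply: iter_mean_le_bound => // v.
by rewrite -cat_rcons sqr_le_lam// size_rcons size_tuple.
Qed.

(* [psi u] is [iter t.+1 child_mean (a ^ 2) u - phi u] and the first term is the mean
   of [phi] over the children of [u]: the sum telescopes until the stopping nodes,
   where [phi <= lam ^ 2] still holds since their parents are not stopped. *)
Lemma energy_bound n u : phi u <= lam ^+ 2 ->
  \sum_(i < n) iter i child_mean psi u <= lam ^+ 2 - phi u.
Proof.
have psi0 i w : ~~ alive c w -> iter i child_mean psi w = 0.
  elim: i w => [|i IHi] w naw; first by rewrite /= /psi (negbTE naw).
  by rewrite iterS; apply: child_mean_const => // o; apply: IHi; rewrite /= negb_and naw orbT.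
elim: n u => [|n IHn] u phiu; first by rewrite big_ord0 subr_ge0.
have [au|/psi0 nau] := boolP (alive c u); last first.
  by rewrite big1 ?subr_ge0// => i _; rewrite nau.
rewrite big_ord_recl /= -child_mean_sum {1}/psi au iter_mean_var.
have : child_mean (fun x => \sum_(i < n) iter i child_mean psi x) u <=
    child_mean (fun w => lam ^+ 2 - phi w) u.
  by apply: ler_child_mean => // o; apply/IHn/phi_le_lam/aliveW.
rewrite (_ : child_mean (fun w => lam ^+ 2 - phi w) u = lam ^+ 2 - child_mean phi u); last first.
  rewrite (child_meanD (fun=> lam ^+ 2)) (@child_mean_const _ _ o0 (fun=> _) (lam ^+ 2))//.
  by rewrite -[in RHS]mulN1r -child_meanZ; congr (_ + _); apply: eq_child_mean => o; rewrite mulN1r.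
rewrite iterS -/phi; lra.
Qed.

(** The root has no parent to appeal to; instead each value of [a] at depth [t] is a mean of values
    at depth [t.+1], which [c [::]] controls. *)
Lemma phi_nil_le_lam : ~~ c [::] -> phi [::] <= lam ^+ 2.
Proof.
move=> c0; apply: iter_mean_le_bound => // v.
rewrite -(a_mean (v ++ _)).
have H o : `|a (o :: (v ++ [::]))| <= lam.
  rewrite cats0; move: c0 => /existsPn/(_ [tuple of o :: v]).
  by rewrite -leNgt cats0.
have : `|child_mean a (v ++ [::])| <= lam.
  rewrite ler_norml; apply/andP; split.
    rewrite -(@child_mean_const _ _ o0 (fun=> - lam) (- lam) (v ++ [::]))//.
    by apply: ler_child_mean => // o; have := H o; rewrite ler_norml => /andP[].
  rewrite -(@child_mean_const _ _ o0 (fun=> lam) lam (v ++ [::]))//.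
  by apply: ler_child_mean => // o; have := H o; rewrite ler_norml => /andP[].
by move=> ?; rewrite -[leLHS]real_normK ?num_real// ler_pXn2r ?nnegrE.
Qed.

(** If the root already satisfies [c], no node is alive and every term vanishes; otherwise the
    telescoping bound applies at the root. *)
Lemma total_energy n : \sum_(i < n) iter i child_mean psi [::] <= lam ^+ 2.
Proof.
have [c0|c0] := boolP (c [::]); last first.
  apply: (le_trans (energy_bound n (phi_nil_le_lam c0))).
  by rewrite gerBl; apply: iter_mean_ge0 => // w; exact: sqr_ge0.
rewrite big1 ?sqr_ge0// => i _.
apply/eqP; rewrite eq_le; apply/andP; split.
  rewrite -[leRHS](@iter_mean_const _ _ o0 i 0 [::]).
  apply: iter_mean_le_bound => // v; rewrite iter_mean_const// cats0 /psi.
  case: ifP => // /aliveP /(_ (v : seq O) [::]).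
  by rewrite cats0 c0 => /(_ erefl).
rewrite iter_mean_words mulr_ge0 ?exprn_ge0 ?(ltW (card_inv_gt0 _ o0))// sumr_ge0// => v _.
rewrite cats0 /psi; case: ifP => // /aliveP /(_ (v : seq O) [::]).
by rewrite cats0 c0 => /(_ erefl).
Qed.

Lemma stopped_sumE o w : stopped_sum c s D (o :: w) = stopped_sum c s D w + d (o :: w).
Proof. by []. Qed.

Lemma d_mean w : child_mean d w = 0.
Proof.
have [H|H] := boolP ((s <= size w)%N && alive c (drop s w)); last first.
  by apply: child_mean_const => // o; rewrite /d (negbTE H).
by rewrite -(@D_mean w) ?(andP H).1//; apply: eq_child_mean => o; rewrite /d H.
Qed.

(** The increments at the children of [w] come from the ancestor [drop s w], whose being alive
    decides whether they are kept. *)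
Lemma d_sqr_le w : (s <= size w)%N ->
  child_mean (fun w => d w ^+ 2) w <= C0 * A ^+ 2 * psi (drop s w).
Proof.
move=> sw; rewrite -[leRHS](@child_mean_const _ _ o0 (fun=> _) _ w (fun=> erefl)).
apply: ler_child_mean => // o; rewrite /d sw /psi andTb.
case: ifP => _; last by rewrite mulr0 expr0n.
by rewrite -{1}(cat_take_drop s w) -cat_cons D_bound//= size_takel.
Qed.

Lemma quadratic_variation n :
  \sum_(j < n) iter j child_mean (child_mean (fun w => d w ^+ 2)) [::] <=
    C0 * A ^+ 2 * lam ^+ 2.
Proof.
have q_ge0 j : 0 <= iter j child_mean (child_mean (fun w => d w ^+ 2)) [::].
  by rewrite -iterSr; apply: iter_mean_ge0 => // w; rewrite sqr_ge0.
have C0A : 0 <= C0 * A ^+ 2 by rewrite mulr_ge0 ?sqr_ge0// (le_trans _ C0_ge1).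
(* The sum is padded to [s + n] terms; the first [s] vanish because no increment is kept before
   depth [s.+1]. The others are compared with the energy [s] levels higher. *)
apply: (@le_trans _ _
  (\sum_(j < s + n) iter j child_mean (child_mean (fun w => d w ^+ 2)) [::])).
  by rewrite addnC big_split_ord /= lerDl sumr_ge0.
rewrite big_split_ord /= big1 ?add0r => [|j _]; last first.
  apply/eqP; rewrite eq_le q_ge0 andbT.
  rewrite -[leRHS](@iter_mean_const _ _ o0 j 0 [::]); apply: ler_iter_mean => // w.
  rewrite addn0 => sw; rewrite le_eqVlt; apply/orP; left; apply/eqP.
  by apply: child_mean_const => // o; rewrite /d sw leqNgt ltn_ord expr0n.
apply: (@le_trans _ _ (\sum_(i < n) C0 * A ^+ 2 * iter i child_mean psi [::])).
  apply: ler_sum => i _; rewrite addnC iterD -iter_meanZ.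
  apply: ler_iter_mean => // w _.
  (* The bound depends only on the ancestor, so averaging over the [s] levels in between leaves it
     unchanged. *)
  rewrite -[leRHS](@iter_mean_drop _ _ o0 s (fun w => C0 * A ^+ 2 * psi w)).
  by apply: ler_iter_mean => // w' sw'; apply: d_sqr_le; rewrite sw' leq_addr.
by rewrite -mulr_sumr ler_wpM2l// total_energy.
Qed.

(** The variance is at most the second moment [t.+1] levels below [u], hence at most [lam ^+ 2].
    Since [C0] is at least 1, it may replace its square root. *)
Lemma D_le v u : ~~ c u -> size v = s.+1 -> `|D (v ++ u)| <= C0 * A * lam.
Proof.
move=> cu vs; have C0_ge0 : 0 <= C0 by rewrite (le_trans _ C0_ge1).
have H : 0 <= C0 * A * lam by rewrite !mulr_ge0.
rewrite -(@ler_pXn2r _ 2) ?nnegrE// real_normK ?num_real//.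
apply: (le_trans (D_bound u vs)).
rewrite (_ : (C0 * A * lam) ^+ 2 = C0 * A ^+ 2 * (C0 * lam ^+ 2)); last by ring.
rewrite ler_wpM2l ?mulr_ge0 ?sqr_ge0//.
apply: (@le_trans _ _ (lam ^+ 2)); last by rewrite ler_peMl ?sqr_ge0.
rewrite iter_mean_var lerBlDr ler_wpDr//.
  by apply: iter_mean_ge0 => // w; exact: sqr_ge0.
by apply: iter_mean_le_bound => // w; rewrite sqr_le_lam// size_tuple.
Qed.

(** The degenerate case, in which the threshold [k * A * lam] is zero and cannot be divided by. *)
Lemma stopped_sum0 w : A * lam = 0 -> stopped_sum c s D w = 0.
Proof.
move=> Al0; elim: w => // o w IHw; rewrite stopped_sumE IHw add0r /d.
case: ifP => // /andP[sw /aliveW /D_le H].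
apply/eqP; rewrite -normr_le0 -{1}(cat_take_drop s w) -cat_cons.
by rewrite (le_trans (H (o :: take s w) _))//= ?size_takel// -mulrA Al0 mulr0.
Qed.

Lemma hit_stopped_sum k n : 0 < k ->
  hit (fun w => k * A * lam < `|stopped_sum c s D w|) n [::] <= C0 / k ^+ 2.
Proof.
move=> k0; have C0_ge0 : 0 <= C0 by rewrite (le_trans _ C0_ge1).
have [Al0|Al0] := eqVneq (A * lam) 0.
  rewrite hit0 ?divr_ge0 ?sqr_ge0// => w.
  by rewrite stopped_sum0// normr0 -leNgt -mulrA Al0 mulr0.
have Al_gt0 : 0 < A * lam by rewrite lt_neqAle eq_sym Al0 mulr_ge0.
have k1_gt0 : 0 < k * A * lam by rewrite -mulrA mulr_gt0.
have := hit_kolmogorov (k := k * A * lam) o0 n [::] (ltW k1_gt0) stopped_sumE d_mean.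
rewrite /= expr0n add0r => /le_trans/(_ (quadratic_variation n)).
rewrite -ler_pdivlMl ?exprn_gt0// => /le_trans; apply.
rewrite le_eqVlt; apply/orP; left; apply/eqP.
rewrite -mulrA exprMn -[A ^+ 2]/(A * A); field.
by move: Al0; rewrite mulf_eq0 negb_or => /andP[-> ->]; rewrite gt_eqF.
Qed.

Lemma hit_stop k n (r : K) : 0 < k ->
  (forall n, hit (fun w => lam < `|a w|) n [::] <= r) ->
  hit (stop s t a D lam (k * A * lam)) n [::] <= b ^+ t.+1 * r + C0 / k ^+ 2.
Proof.
move=> k0 hr; apply: (le_trans (hit_or _ o0 c (fun w => k * A * lam < `|stopped_sum c s D w|) n [::])).
apply: lerD.
  apply: (le_trans (hit_spread _ _)).
  by rewrite ler_wpM2l ?exprn_ge0 ?(ltW b_gt0).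
exact: hit_stopped_sum.
Qed.

(* [stopped_sum] at [u] only sees the pieces starting at least [s.+1] levels above
   [u]; the remaining ones are bounded one by one by [D_le]. *)
Lemma path_bound k u v : alive (stop s t a D lam (k * A * lam)) u -> (size v <= s.+1)%N ->
  `|\sum_(i < size (v ++ u) - s) D (drop i (v ++ u))| <= (k + (size v)%:R * C0) * A * lam.
Proof.
set st := stop _ _ _ _ _ _ => au.
have C0_ge0 : 0 <= C0 by rewrite (le_trans _ C0_ge1).
have sumE o w : \sum_(i < size (o :: w) - s) D (drop i (o :: w)) =
    \sum_(i < size w - s) D (drop i w) + (if (s <= size w)%N then D (o :: w) else 0).
  rewrite [size _]/=; case: leqP => sw; last first.
    by rewrite addr0 (eqP (_ : (size w).+1 - s == 0)%N) ?subn_eq0// (eqP (_ : size w - s == 0)%N)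
       ?subn_eq0 1?ltnW// !big_ord0.
  by rewrite subSn// big_ord_recl addrC.
have alive_c w : alive st w -> alive c w.
  move=> /aliveP H; apply/aliveP => v' w' /H; rewrite /st /stop /= negb_or => /andP[].
  by [].
elim: v => [_|o v IHv vs]; rewrite ?cat0s.
  have -> : \sum_(i < size u - s) D (drop i u) = stopped_sum c s D u.
    elim: u au => [|o u IHu] au; first by rewrite big_ord0.
    rewrite sumE stopped_sumE IHu; last by move: au => /= /andP[].
    congr (_ + _); rewrite /d; case: leqP => //= su.
    by rewrite alive_drop//; apply: alive_c; move: au => /= /andP[].
  by rewrite mul0r addr0; move: (aliveW au); rewrite /st /stop negb_or -leNgt => /andP[].
rewrite cat_cons sumE.
rewrite (_ : (k + _) * A * lam = (k + (size v)%:R * C0) * A * lam + C0 * A * lam); last first.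
  by rewrite [size (o :: v)]/= -[in LHS]natr1; ring.
apply: (le_trans (ler_normD _ _)); apply: lerD; first exact/IHv/ltnW.
case: ifP => su; last by rewrite normr0 !mulr_ge0.
rewrite -(cat_take_drop s (v ++ u)) -cat_cons D_le//= ?size_takel//.
apply/aliveW/alive_c.
by rewrite drop_cat ltnNge (_ : (size v <= s)%N)//= alive_drop.
Qed.

End TreeShift.

(** * Dyadic cubes *)

Definition child {d : nat} (Q : dcube d) (o : d.-tuple bool) : dcube d :=
  (Q.1 + 1, [tuple 2 * tnth Q.2 i + (tnth o i)%:Z | i < d]).

(** Identifies the tree of words with the dyadic subcubes of [Q]: the head is the last subdivision,
    so dropping letters gives ancestors. *)
Definition subcube {d : nat} (Q : dcube d) (w : seq (d.-tuple bool)) : dcube d :=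
  foldr (fun o P => child P o) Q w.

Definition cube_at {R : realType} {d : nat} (k : int) (x : d.-tuple R) : dcube d :=
  (k, [tuple Num.floor (tnth x i * 2 ^ k) | i < d]).

(** A sample point of the cube: it witnesses that nested cubes meet and reads off the values of
    functions constant on the cube. *)
Definition corner (R : realType) {d : nat} (Q : dcube d) : d.-tuple R :=
  [tuple (tnth Q.2 i)%:~R * dside R Q | i < d].

Section Dyadic.
Variables (R : realType) (d : nat).
Implicit Types (Q P : dcube d) (x : d.-tuple R) (o : d.-tuple bool) (w v : seq (d.-tuple bool)).

Lemma dside_gt0 Q : 0 < dside R Q.
Proof. by rewrite /dside exprz_gt0. Qed.

(** Taking floors recovers the cube of a given generation from any of its points, so membership
    becomes an equation between cubes. *)
Lemma dsetE Q x : dset R Q x <-> Q = cube_at Q.1 x.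
Proof.
have H i : (tnth Q.2 i)%:~R * dside R Q <= tnth x i < ((tnth Q.2 i)%:~R + 1) * dside R Q
   = (Num.floor (tnth x i * 2 ^ Q.1) == tnth Q.2 i).
  rewrite -ler_pdivlMr ?dside_gt0// -ltr_pdivrMr ?dside_gt0//.
  by rewrite /dside invr_expz opprK floor_eq intrD.
split => [Qx|QE].
  rewrite [LHS]surjective_pairing; congr pair; apply: eq_from_tnth => i.
  by rewrite tnth_mktuple; apply/eqP; rewrite eq_sym -H; apply/andP; exact: Qx.
by move=> i; apply/andP; rewrite H [in X in _ == X]QE tnth_mktuple.
Qed.

Lemma cube_atP k x : dset R (cube_at k x) x.
Proof. exact/dsetE. Qed.

Lemma dset_eq P Q x : dset R P x -> dset R Q x -> P.1 = Q.1 -> P = Q.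
Proof. by move=> /dsetE-> /dsetE-> /= ->. Qed.

Lemma corner_dset Q : dset R Q (corner R Q).
Proof.
move=> i; rewrite tnth_mktuple; split => //.
by rewrite ltr_pM2r ?dside_gt0// ltrDl.
Qed.

Lemma cube_at_child k x : exists o, cube_at (k + 1) x = child (cube_at k x) o.
Proof.
exists [tuple Num.floor (tnth x i * 2 ^ (k + 1)) != 2 * Num.floor (tnth x i * 2 ^ k) | i < d].
congr pair; apply: eq_from_tnth => i; rewrite !tnth_mktuple /=.
set y := tnth x i * 2 ^ k.
have -> : tnth x i * 2 ^ (k + 1) = 2 * y.
  by rewrite /y expfzDr ?pnatr_eq0// expr1z; ring.
have := floor_itv y; have := floor_itv (2 * y).
set m := Num.floor (2 * y); set n := Num.floor y.
rewrite !intrD !mulr1z => /andP[h1 h2] /andP[h3 h4].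
have l1 : 2 * n < m + 1 by rewrite -(ltr_int R) !(intrM, intrD); lra.
have l2 : m < 2 * n + 2 by rewrite -(ltr_int R) !(intrM, intrD); lra.
by case: eqP => /= [->|]; lia.
Qed.

Lemma dset_child_sub Q o x : dset R (child Q o) x -> dset R Q x.
Proof.
move=> /dsetE /(congr1 snd)/= QoE; apply/dsetE.
rewrite [LHS]surjective_pairing; congr pair; apply: eq_from_tnth => i.
have := congr1 (fun t => tnth t i) QoE; rewrite !tnth_mktuple => E.
apply/esym/eqP; rewrite floor_eq.
have := floor_itv (tnth x i * 2 ^ (Q.1 + 1)); rewrite -E.
rewrite expfzDr ?pnatr_eq0// expr1z !intrD intrM.
by case: (tnth o i) => /=; lra.
Qed.

Lemma dset_childP Q x : dset R Q x -> exists o, dset R (child Q o) x.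
Proof.
move=> /dsetE QE; have [ o oE] := cube_at_child Q.1 x.
by exists o; rewrite QE -oE; exact: cube_atP.
Qed.

Lemma child_inj Q Q' o o' : child Q o = child Q' o' -> Q = Q' /\ o = o'.
Proof.
move=> E0; have /addIr Q1 := congr1 fst E0; have /= E := congr1 snd E0.
have H i : 2 * tnth Q.2 i + (tnth o i)%:Z = 2 * tnth Q'.2 i + (tnth o' i)%:Z.
  by have := congr1 (fun t => tnth t i) E; rewrite !tnth_mktuple.
split.
  rewrite [LHS]surjective_pairing [RHS]surjective_pairing Q1; congr pair.
  by apply: eq_from_tnth => i; move: (H i); case: (tnth o i); case: (tnth o' i) => /=; lia.
by apply: eq_from_tnth => i; move: (H i); case: (tnth o i); case: (tnth o' i) => //=; lia.
Qed.

Lemma subcube_gen Q w : (subcube Q w).1 = Q.1 + (size w)%:Z.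
Proof. by elim: w => [|o w IHw] /=; rewrite ?addr0// IHw -addrA -PoszD addn1. Qed.

Lemma subcube_cat Q v w : subcube Q (v ++ w) = subcube (subcube Q w) v.
Proof. by rewrite /subcube foldr_cat. Qed.

Lemma subcube_sub Q w x : dset R (subcube Q w) x -> dset R Q x.
Proof. by elim: w => //= o w IHw /dset_child_sub. Qed.

Lemma dset_subcubeP Q x n : dset R Q x -> exists2 w, size w = n & dset R (subcube Q w) x.
Proof.
move=> Qx; elim: n => [|n [w wn Qwx]]; first by exists [::].
by have [ o ?] := dset_childP Qwx; exists (o :: w); rewrite /= ?wn.
Qed.

Lemma subcube_inj Q w w' : subcube Q w = subcube Q w' -> w = w'.
Proof.
move=> E; have : size w = size w'.
  by move/(congr1 fst): E; rewrite !subcube_gen => /addrI[].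
elim: w w' E => [[]//|o w IHw [|o' w']//= E [sw]].
by have [/IHw -> // ->] := child_inj E.
Qed.

Lemma subcube_eq Q w w' x : size w = size w' ->
  dset R (subcube Q w) x -> dset R (subcube Q w') x -> w = w'.
Proof.
move=> sw wx w'x; apply: (@subcube_inj Q); apply: dset_eq wx w'x _.
by rewrite !subcube_gen sw.
Qed.

Lemma dset_meet P Q x n : dset R P x -> dset R Q x -> P.1 = Q.1 + n%:Z ->
  exists2 w, size w = n & P = subcube Q w.
Proof.
move=> Px Qx PQ; have [w wn Qwx] := dset_subcubeP n Qx; exists w => //.
by apply: dset_eq Px Qwx _; rewrite subcube_gen wn.
Qed.

Lemma dset_sub_subcube P Q n : dset R P `<=` dset R Q -> P.1 = Q.1 + n%:Z ->
  exists2 w, size w = n & P = subcube Q w.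
Proof. by move=> PQ; apply: dset_meet (corner_dset P) (PQ _ (corner_dset P)). Qed.

Lemma dset_subcube_sub Q w : dset R (subcube Q w) `<=` dset R Q.
Proof. by move=> x; exact: subcube_sub. Qed.

Lemma DlE Q n P : Dl R Q n P <-> exists2 w, size w = n & P = subcube Q w.
Proof.
split => [[P1 PQ]|[w <- ->]]; first exact: dset_sub_subcube PQ P1.
by split; [rewrite subcube_gen|exact: dset_subcube_sub].
Qed.

Hypothesis d_gt0 : (0 < d)%N.

(** Otherwise [Q] would be a proper descendant of [P], and another descendant of [P] of the same
    size would lie in [Q]. *)
Lemma dset_sub_le P Q : dset R P `<=` dset R Q -> Q.1 <= P.1.
Proof.
move=> PQ; rewrite leNgt; apply/negP => lt_PQ.
have E : Q.1 = P.1 + `|Q.1 - P.1|%N%:Z by lia.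
have [w wn QE] := dset_meet (PQ _ (corner_dset P)) (corner_dset P) E.
have [ o [v wE]] : exists o v, w = o :: v.
  by case: (w) wn => [/= wn|o v _]; [lia|exists o, v].
(* Flipping every bit of the last choice gives a different cube because there is at least one
   coordinate. *)
pose w' := [tuple of map negb o] :: v.
have w'w : size w' = size w by rewrite wE.
have P' : dset R P (corner R (subcube P w')) by apply/subcube_sub/corner_dset.
have : w' = w.
  apply: (subcube_eq (Q := P) w'w (corner_dset _)); rewrite -QE; exact: PQ.
rewrite wE => /(congr1 (fun s => tnth (head o s) (Ordinal d_gt0))) /=.
by rewrite tnth_map; case: (tnth o _).
Qed.

Lemma DsubE Q P : Dsub R Q P <-> exists w, P = subcube Q w.
Proof.
split => [PQ|[w ->]]; last exact: dset_subcube_sub.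
have E : P.1 = Q.1 + `|P.1 - Q.1|%N%:Z by have := dset_sub_le PQ; lia.
by have [w _ ->] := dset_sub_subcube PQ E; exists w.
Qed.

End Dyadic.

(** * Measure and integrals of cubes *)

Section LebesgueMeasure.
Variable R : realType.
Local Open Scope ereal_scope.

Let pcons n (p : R * n.-tuple R) : n.+1.-tuple R := cons_tuple p.1 p.2.

Let measurable_pcons n : measurable_fun setT (@pcons n).
Proof. exact: measurable_cons. Qed.

(** The iterated integral is the image under [cons_tuple] of a product measure. Sigma-finiteness is
    carried through the induction because forming the next product requires it. *)
Lemma leb_measure n : exists mu : {sigma_finite_measure set (n.-tuple R) -> \bar R},
  @leb R n = mu :> (set _ -> _).
Proof.
elim: n => [|n [mu muE]].
  exists [the {sigma_finite_measure set (0.-tuple R) -> \bar R} of dirac [tuple]].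
  apply/funext => A /=; rewrite diracE /=.
  by case: asboolP => A0; [rewrite mem_set|rewrite memNset].
pose P : {measure set (n.+1.-tuple R) -> \bar R} :=
  measure_function_pushforward__canonical__measure_function_Measure
    (@lebesgue_measure R \x mu) (@measurable_pcons n).
have PE : @leb R n.+1 = P.
  apply/funext => A /=; rewrite /P /= /pushforward /product_measure1.
  apply: eq_integral => x _ /=; rewrite muE; congr (mu _).
  by apply/seteqP; split => t /=; rewrite /xsection /= inE.
pose uncons (t : n.+1.-tuple R) : R * n.-tuple R := (thead t, [tuple of behead t]).
have muncons : measurable_fun setT uncons.
  by apply: measurable_fun_pair; [exact: measurable_tnth|exact: measurable_behead].
have unconsK p : uncons (pcons p) = p.
  by case: p => x t; congr pair; apply: val_inj.
have Psf : sigma_finite setT P.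
  have /sigma_finiteP[F [FT ndF Fb]] := sigma_finiteT (@lebesgue_measure R).
  have /sigma_finiteP[G [GT ndG Gb]] := sigma_finiteT mu.
  (* Both exhausting sequences increase, so the products of sets with equal index already cover the
     space. *)
  exists (fun i => uncons @^-1` (F i `*` G i)).
    apply/seteqP; split => // t _.
    have [i _ Fi] : (\bigcup_i F i) (thead t) by rewrite -FT.
    have [j _ Gj] : (\bigcup_i G i) [tuple of behead t] by rewrite -GT.
    exists (maxn i j) => //; split => /=.
      by move: (thead t) Fi; exact/subsetPset/ndF/leq_maxl.
    by move: [tuple of behead t] Gj; exact/subsetPset/ndG/leq_maxr.
  move=> i; have [mF Foo] := Fb i; have [mG Goo] := Gb i; split.
    by rewrite -[X in measurable X]setTI; apply: muncons => //; exact: measurableX.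
  rewrite /P /= /pushforward (_ : _ @^-1` _ = F i `*` G i); last first.
    by apply/seteqP; split => p Hp; [rewrite -(unconsK p)|rewrite -(unconsK p) in Hp].
  by rewrite product_measure1E// lte_mul_pinfty// ge0_fin_numE.
pose Pm := Measure_isSigmaFinite.Build _ _ _ P Psf.
by exists (HB.pack_for {sigma_finite_measure set (n.+1.-tuple R) -> \bar R} (P : set _ -> _) P Pm).
Qed.

Lemma leb_set0 n : @leb R n set0 = 0.
Proof. by have [mu ->] := leb_measure n; rewrite measure0. Qed.

Lemma leb_ge0 n A : 0 <= @leb R n A.
Proof. by have [mu ->] := leb_measure n; rewrite measure_ge0. Qed.

Lemma leb_sigma_additive n : semi_sigma_additive (@leb R n).
Proof. by have [mu ->] := leb_measure n; exact: measure_semi_sigma_additive. Qed.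

HB.instance Definition _ n :=
  isMeasure.Build _ _ _ (@leb R n) (leb_set0 n) (@leb_ge0 n) (@leb_sigma_additive n).

End LebesgueMeasure.

Section CubeMeasure.
Variable R : realType.

Lemma dset_cons n (Q : dcube n.+1) (x : R) (t : n.-tuple R) :
  dset R Q (cons_tuple x t) <->
  ((thead Q.2)%:~R * dside R Q <= x /\ x < ((thead Q.2)%:~R + 1) * dside R Q) /\
  dset R (Q.1, [tuple of behead Q.2]) t.
Proof.
have thE (T : Type) (s : n.+1.-tuple T) j : tnth [tuple of behead s] j = tnth s (lift ord0 j).
  by rewrite [in RHS](tuple_eta s) tnthS.
split => [H|[H0 H] i].
  split; first by have := H ord0; rewrite tnth0.
  by move=> i; have := H (lift ord0 i); rewrite tnthS thE.
case: (unliftP ord0 i) => [j|] ->; last by rewrite tnth0.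
by rewrite tnthS -thE; exact: H.
Qed.

(** Slicing by the first coordinate: a slice is a cube of one dimension less if the coordinate lies
    in the first side, and empty otherwise. *)
Lemma volE n (Q : dcube n) : vol R Q = (dside R Q ^+ n)%:E.
Proof.
rewrite /vol; elim: n Q => [|n IHn] Q.
  by rewrite /= expr0; case: asboolP => // -[] [].
pose a := (thead Q.2)%:~R * dside R Q; pose b := ((thead Q.2)%:~R + 1) * dside R Q.
transitivity (\int[@lebesgue_measure R]_x ((dside R Q ^+ n)%:E * (\1_(`[a, b[%classic) x)%:E))%E.
  apply: eq_integral => x _; rewrite indicE.
  have [xab|xab] := boolP (x \in `[a, b[%classic).
    rewrite mule1 -(IHn (Q.1, [tuple of behead Q.2])); congr leb.
    apply/seteqP; split => t /=; first by move/dset_cons => [].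
    move=> H; apply/dset_cons; split => //.
    by move/set_mem: xab; rewrite /= in_itv /= => /andP.
  rewrite mule0; have -> : [set t : n.-tuple R | dset R Q (cons_tuple x t)] = set0; last exact: leb_set0.
  apply/seteqP; split => t //= /dset_cons[/andP xab' _].
  by move/negP: xab; apply; rewrite mem_set//= in_itv.
rewrite integralZl//; last exact: integrable_indic_itv.
rewrite integral_indic// setIT.
have mab : lebesgue_measure (`[a, b[%classic : set R) = (dside R Q)%:E.
  rewrite lebesgue_measure_itv /= lte_fin ltr_pM2r ?dside_gt0// ltrDl ltr01 -EFinB.
  by rewrite /a /b -mulrBl addrAC subrr add0r mul1r.
by rewrite exprSr EFinM; congr (_ * _)%E; exact: mab.
Qed.

Variable d : nat.
Implicit Types (Q P : dcube d) (f g : d.-tuple R -> R).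

Lemma measurable_dset Q : measurable (dset R Q).
Proof.
rewrite (_ : dset R Q = \big[setI/setT]_(i < d) ((fun x => tnth x i) @^-1`
    `[(tnth Q.2 i)%:~R * dside R Q, ((tnth Q.2 i)%:~R + 1) * dside R Q[ )); last first.
  rewrite -bigcap_seq; apply/seteqP; split => [x Qx i _|x Qx i].
    by rewrite /= in_itv /=; apply/andP; exact: Qx.
  by apply/andP; have := Qx i (mem_index_enum i); rewrite /= in_itv.
apply: bigsetI_measurable => i _; rewrite -[X in measurable X]setTI.
exact: measurable_tnth.
Qed.

Local Notation mu := (@leb R d).
Local Notation O := (d.-tuple bool).

Lemma integrable_dset f Q : mu.-integrable setT (EFin \o f) ->
  mu.-integrable (dset R Q) (EFin \o f).
Proof. by apply: integrableS => //; exact: measurable_dset. Qed.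

(** With [g] a Haar function this computes the pairing; with [f] constant it gives integrals of step
    functions, and with [c] constant the additivity over children. *)
Lemma Rintegral_step f g Q (c : O -> R) : mu.-integrable (dset R Q) (EFin \o f) ->
  (forall x, ~ dset R Q x -> g x = 0) ->
  (forall o x, dset R (child Q o) x -> g x = c o) ->
  \int[mu]_x (f x * g x) = \sum_o c o * \int[mu]_(x in dset R (child Q o)) f x.
Proof.
move=> fQ g0 gc.
have fo o : mu.-integrable (dset R (child Q o)) (EFin \o f).
  apply: integrableS fQ; [exact: measurable_dset|exact: measurable_dset|].
  by move=> x; exact: dset_child_sub.
have fo' o : mu.-integrable setT (fun x => ((c o)%:E * ((EFin \o f) \_ (dset R (child Q o))) x)%E).
  by apply: integrableZl => //; exact/(integrable_mkcond _ (measurable_dset _)).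
have E x : (f x * g x)%:E = (\sum_o (c o)%:E * ((EFin \o f) \_ (dset R (child Q o))) x)%E.
  have [Qx|Qx] := pselect (dset R Q x); last first.
    rewrite g0// mulr0 big1// => o _; rewrite patchE memNset ?mule0//.
    by move=> /dset_child_sub.
  have [ o ox] := dset_childP Qx; rewrite (bigD1 o)//= big1 ?adde0; last first.
    move=> o' oo'; rewrite patchE memNset ?mule0// => o'x.
    by move/eqP: oo'; apply; case: (child_inj (dset_eq o'x ox erefl)).
  by rewrite patchE mem_set//= (gc o)// -EFinM mulrC.
rewrite /Rintegral (eq_integral _ _ (fun x _ => E x)) integral_sum//.
rewrite -sum_fine => [|o _]; last exact: integrable_fin_num.
apply: eq_bigr => o _; rewrite integralZl//; last first.
  exact/(integrable_mkcond _ (measurable_dset _)).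
by rewrite -integral_mkcond fineM//; apply: integrable_fin_num (fo o) => //; exact: measurable_dset.
Qed.

Lemma Rintegral_children f Q : mu.-integrable (dset R Q) (EFin \o f) ->
  \int[mu]_(x in dset R Q) f x = \sum_o \int[mu]_(x in dset R (child Q o)) f x.
Proof.
move=> fQ; rewrite Rintegral_mkcond.
rewrite [RHS](eq_bigr (fun o => 1 * \int[mu]_(x in dset R (child Q o)) f x)); last first.
  by move=> o _; rewrite mul1r.
rewrite -(Rintegral_step (g := \1_(dset R Q)) (c := fun=> 1) fQ).
- by apply: eq_Rintegral => x _; rewrite patchE indicE; case: ifP => _; rewrite ?mulr1 ?mulr0.
- by move=> x Qx; rewrite indicE memNset.
- by move=> o x /dset_child_sub Qx; rewrite indicE mem_set.
Qed.

Definition volr Q : R := dside R Q ^+ d.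

Lemma volr_gt0 Q : 0 < volr Q.
Proof. by rewrite exprn_gt0// dside_gt0. Qed.

Lemma fine_vol Q : fine (vol R Q) = volr Q.
Proof. by rewrite volE. Qed.

Lemma leb_dset Q : leb d (dset R Q) = (volr Q)%:E.
Proof. exact: volE. Qed.

Lemma card_children : #|{: O}| = (2 ^ d)%N.
Proof. by rewrite card_tuple card_bool. Qed.

Lemma volr_child Q o : volr (child Q o) = #|{: O}|%:R^-1 * volr Q.
Proof.
rewrite /volr /dside /= opprD expfzDr ?pnatr_eq0// exprMn mulrC card_children natrX.
by rewrite -exprVn.
Qed.

Lemma volr_subcube Q w : volr (subcube Q w) = #|{: O}|%:R^-1 ^+ size w * volr Q.
Proof.
by elim: w => [|o w IHw] /=; rewrite ?expr0 ?mul1r// volr_child IHw exprS mulrA.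
Qed.

Lemma Rintegral_avg f Q : \int[mu]_(x in dset R Q) f x = volr Q * avg f Q.
Proof. by rewrite /avg fine_vol mulrC divfK ?gt_eqF ?volr_gt0. Qed.

Lemma avg_children f Q : mu.-integrable (dset R Q) (EFin \o f) ->
  avg f Q = #|{: O}|%:R^-1 * \sum_o avg f (child Q o).
Proof.
move=> fQ; apply: (mulfI (lt0r_neq0 (volr_gt0 Q))).
rewrite -Rintegral_avg Rintegral_children// mulrA mulr_sumr; apply: eq_bigr => o _.
by rewrite Rintegral_avg volr_child [volr Q * _]mulrC.
Qed.

Lemma avg_child_mean f Q w : mu.-integrable setT (EFin \o f) ->
  child_mean (fun w => avg f (subcube Q w)) w = avg f (subcube Q w).
Proof. by move=> fi; rewrite [RHS]avg_children//; exact: integrable_dset. Qed.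

Lemma avg_norm_le f Q : mu.-integrable setT (EFin \o f) ->
  `|avg f Q| <= avg (fun x => `|f x|) Q.
Proof.
move=> fi; rewrite /avg fine_vol normrM normfV (gtr0_norm (volr_gt0 Q)).
rewrite ler_pM2r ?invr_gt0 ?volr_gt0//; apply: le_normr_Rintegral.
  exact: measurable_dset.
exact: integrable_dset.
Qed.

End CubeMeasure.

(** * Hitting fractions as measures, and quantiles of the maximal function *)

Section LevelSets.
Variables (R : realType) (d : nat).
Local Notation mu := (@leb R d).
Local Notation O := (d.-tuple bool).
Implicit Types (Q P : dcube d) (E : set (d.-tuple R)) (c : pred (seq O)).

Lemma leb_le (A B : set (d.-tuple R)) : measurable A -> measurable B -> A `<=` B -> (leb d A <= leb d B)%E.
Proof. by move=> mA mB AB; apply: (le_measure mu) => //; rewrite inE. Qed.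

Lemma leb_bigcup_le (F : nat -> set (d.-tuple R)) (k : \bar R) :
  (forall n, measurable (F n)) -> nondecreasing_seq F ->
  (forall n, leb d (F n) <= k)%E -> (leb d (\bigcup_n F n) <= k)%E.
Proof.
move=> mF ndF Fk.
have cvF := nondecreasing_cvg_mu (mu := mu) mF (bigcup_measurable (fun n _ => mF n)) ndF.
rewrite -(cvg_lim _ cvF)//; apply: lime_le; first by apply/cvg_ex; eexists; exact: cvF.
by near=> n; exact: Fk.
Unshelve. all: by end_near.
Qed.

Lemma measurable_bigcup_dset (I : countType) (A : set I) (F : I -> dcube d) :
  measurable (\bigcup_(i in A) dset R (F i)).
Proof.
rewrite bigcup_mkcond; apply: countable_bigcupT_measurable => // i.
by case: ifP => // _; exact: measurable_dset.
Qed.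

Lemma leb_children E Q : measurable E ->
  leb d (E `&` dset R Q) = (\sum_o leb d (E `&` dset R (child Q o)))%E.
Proof.
move=> mE.
have -> : E `&` dset R Q = \bigcup_(o in [set: O]) (E `&` dset R (child Q o)).
  apply/seteqP; split => [x [Ex /dset_childP[ o ox]]|x [ o _ [Ex ox]]]; first by exists o.
  by split => //; exact: dset_child_sub ox.
rewrite measure_fin_bigcup//.
- rewrite (fsbigE (index_enum O)) ?index_enum_uniq//; first by apply: eq_bigl => o; rewrite in_setT.
  by move=> o _; rewrite mem_index_enum.
- exact: finite_finset.
- move=> o o' _ _ [x [[_ ox] [_ o'x]]].
  by have [] := child_inj (dset_eq ox o'x erefl).
- by move=> o _; apply: measurableI => //; exact: measurable_dset.
Qed.

Lemma volr_child_mean Q (F : seq O -> R) w :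
  volr R (subcube Q w) * child_mean F w = \sum_o volr R (subcube Q (o :: w)) * F (o :: w).
Proof.
rewrite /child_mean mulrCA mulrA mulr_sumr; apply: eq_bigr => o _.
by rewrite /= volr_child.
Qed.

Lemma leb_dsetI E Q : measurable E -> (leb d (E `&` dset R Q) <= (volr R Q)%:E)%E.
Proof.
move=> mE; rewrite -leb_dset; apply: leb_le; last exact: subIsetr.
  by apply: measurableI => //; exact: measurable_dset.
exact: measurable_dset.
Qed.

Lemma hit_le_leb c Q E n w : measurable E ->
  (forall w, c w -> dset R (subcube Q w) `<=` E) ->
  ((volr R (subcube Q w) * hit c n w)%:E <= leb d (E `&` dset R (subcube Q w)))%E.
Proof.
move=> mE cE; elim: n w => [|n IHn] w; rewrite /hit -/hit; case: ifP => [/cE wE|_].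
- by rewrite mulr1 setIC setIidl// leb_dset.
- by rewrite mulr0 measure_ge0.
- by rewrite mulr1 setIC setIidl// leb_dset.
rewrite volr_child_mean leb_children// -sumEFin.
by apply: lee_sum => o _; exact: IHn.
Qed.

Definition hit_set c Q n w : set (d.-tuple R) :=
  \bigcup_(v in [set v | (size v <= n)%N /\ c (v ++ w)]) dset R (subcube Q (v ++ w)).

Lemma measurable_hit_set c Q n w : measurable (hit_set c Q n w).
Proof. exact: measurable_bigcup_dset. Qed.

Lemma hit_set_sub c Q n w : hit_set c Q n w `<=` dset R (subcube Q w).
Proof. by move=> x [v _]; rewrite subcube_cat; exact: subcube_sub. Qed.

Lemma leb_hit_set c Q n w :
  (leb d (hit_set c Q n w) <= (volr R (subcube Q w) * hit c n w)%:E)%E.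
Proof.
elim: n w => [|n IHn] w; rewrite -(setIidl (@hit_set_sub c Q _ w)) /hit -/hit; case: ifP => cw.
- by rewrite mulr1 leb_dsetI//; exact: measurable_hit_set.
- rewrite mulr0 (_ : hit_set _ _ _ _ = set0) ?set0I ?measure0//.
  apply/seteqP; split => x // [v /= [+ cv]] _.
  by rewrite leqn0 => /nilP v0; move: cv; rewrite v0 cw.
- by rewrite mulr1 leb_dsetI//; exact: measurable_hit_set.
rewrite leb_children; last exact: measurable_hit_set.
rewrite volr_child_mean -sumEFin; apply: lee_sum => o _.
apply: (le_trans _ (IHn (o :: w))); apply: leb_le.
- by apply: measurableI; [exact: measurable_hit_set|exact: measurable_dset].
- exact: measurable_hit_set.
(* The last letter of [v] names the child of [w] that contains [x], hence equals [o]; the rest of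
   [v] is one letter shorter. *)
move=> x [[v [vn cv] vx] ox]; case/lastP: v vn cv vx => [|v o']; first by rewrite cw.
rewrite size_rcons ltnS cat_rcons => vn cv vx.
have <- : o' = o; last by exists v.
move: (vx); rewrite subcube_cat => /subcube_sub /= o'x.
by have [] := child_inj (dset_eq o'x ox erefl).
Qed.

Lemma leb_hit_union c Q (k : R) : (forall n, hit c n [::] <= k) ->
  (leb d (\bigcup_(w in [set w | c w]) dset R (subcube Q w)) <= (volr R Q * k)%:E)%E.
Proof.
move=> hk.
have -> : \bigcup_(w in [set w | c w]) dset R (subcube Q w) = \bigcup_n hit_set c Q n [::].
  apply/seteqP; split => [x [w cw wx]|x [n _ [w [_ cw] wx]]].
    by exists (size w) => //; exists w; rewrite ?cats0 => //=; rewrite cats0.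
  by exists (w ++ [::]).
apply: leb_bigcup_le.
- by move=> n; exact: measurable_hit_set.
- move=> m n mn; apply/subsetPset => x [v [vm cv] vx]; exists v => //; split => //.
  exact: leq_trans mn.
- move=> n; apply: (le_trans (leb_hit_set c Q n [::])).
  by rewrite lee_fin ler_wpM2l// ltW// volr_gt0.
Qed.

Hypothesis d_gt0 : (0 < d)%N.
Variable f : d.-tuple R -> R.
Hypothesis fi : mu.-integrable setT (EFin \o f).

Let big Q (lam : R) : pred (seq O) := fun w => lam < `|avg f (subcube Q w)|.

(** A supremum exceeds [lam] exactly when one of its terms does, so strict superlevel sets are
    unions of cubes. *)
Lemma MQ_level_set Q lam : dset R Q `&` [set x | (lam%:E < MQ f Q x)%E] =
  \bigcup_(w in [set w | big Q lam w]) dset R (subcube Q w).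
Proof.
apply/seteqP; split => x.
  move=> [Qx /ereal_sup_gt[_ [P [/(DsubE R d_gt0)[w ->] wx] <-]]].
  by rewrite lte_fin => ?; exists w.
move=> [w wbig wx]; split; first exact: subcube_sub wx.
rewrite /= (lt_le_trans (y := `|avg f (subcube Q w)|%:E)) ?lte_fin//.
by apply: ereal_sup_ubound; exists (subcube Q w) => //; split => //; exact: dset_subcube_sub.
Qed.

(** The maximal inequality for the averages of [|f|]; it shows that the set defining the quantile is
    nonempty. *)
Lemma hit_avg_le Q (r : R) : 0 < r ->
  exists lam : R, forall n, hit (big Q lam) n [::] <= r.
Proof.
move=> r0; pose F := avg (fun x => `|f x|) Q.
have F0 Q' : 0 <= avg (fun x => `|f x|) Q'.
  exact: le_trans (avg_norm_le Q' fi).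
(* The summand 1 keeps the threshold positive when [f] has zero mean modulus on [Q]. *)
exists (F / r + 1) => n.
have k0 : 0 < F / r + 1 by rewrite ltr_wpDl// divr_ge0 ?F0 ?ltW.
have o0 : O := [tuple false | i < d].
have fni : mu.-integrable setT (EFin \o (fun x => `|f x|)) by exact: (integrable_norm fi).
have := @hit_markov R O o0 (fun w => avg (fun x => `|f x|) (subcube Q w)) _ (big Q (F / r + 1)) n [::]
  (ltW k0) (fun w => F0 _) (fun w => avg_child_mean Q w fni).
rewrite -ler_pdivlMl// => /(_ _)/le_trans; apply.
  by move=> w /ltW /le_trans; apply; exact: avg_norm_le.
rewrite ler_pdivrMl// mulrC mulrDr mulr1 mulrCA divff ?gt_eqF// mulr1.
by rewrite lerDl ltW.
Qed.

(** The infimum is attained since the strict superlevel set at [inf L] is the increasing union of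
    those at [inf L + n.+1%:R^-1]. It is nonnegative since below zero the level set is all of [Q],
    too large as [r < 1]. *)
Lemma Pq_attained Q (r : R) : 0 < r < 1 ->
  exists lam : R, [/\ 0 <= lam, Pq r Q (MQ f Q) = lam%:E &
    forall n, hit (big Q lam) n [::] <= r].
Proof.
move=> /andP[r0 r1].
pose L := [set lam : R | (leb d (dset R Q `&` [set x | (lam%:E < MQ f Q x)%E])
                     <= r%:E * vol R Q)%E].
have Q_gt0 := volr_gt0 R Q.
have rE : (r%:E * vol R Q = (volr R Q * r)%:E)%E by rewrite volE -EFinM mulrC.
have L0 lam : L lam -> 0 <= lam.
  rewrite /L /= MQ_level_set rE => Ll; rewrite leNgt; apply/negP => lam0.
  move: Ll; apply/negP; rewrite -ltNge.
  apply: (@lt_le_trans _ _ (leb d (dset R Q))).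
    by rewrite leb_dset lte_fin gtr_pMr.
  apply: leb_le; [exact: measurable_dset|exact: measurable_bigcup_dset|].
  by move=> x Qx; exists [::] => //; rewrite /= /big; exact: lt_le_trans lam0 _.
have Lne : L !=set0.
  have [lam Hlam] := hit_avg_le Q r0; exists lam.
  by rewrite /L /= MQ_level_set rE; exact: leb_hit_union.
have Llb : has_lbound L by exists 0 => x /L0.
have Linf : has_inf L by split.
have inf0 : 0 <= inf L by apply: lb_le_inf => // x /L0.
exists (inf L); split => //.
  by rewrite /Pq -ereal_inf_EFin.
have Lu n : L (inf L + n.+1%:R^-1).
  have n0 : 0 < n.+1%:R^-1 :> R by rewrite invr_gt0.
  have [l Ll ll] := inf_adherent n0 Linf.
  apply: le_trans Ll; rewrite !MQ_level_set; apply: leb_le; try exact: measurable_bigcup_dset.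
  move=> x [w wb wx]; exists w => //=; rewrite /big; exact: lt_trans ll wb.
have : (leb d (\bigcup_(w in [set w | big Q (inf L) w]) dset R (subcube Q w)) <= (volr R Q * r)%:E)%E.
  have -> : \bigcup_(w in [set w | big Q (inf L) w]) dset R (subcube Q w) =
     \bigcup_n \bigcup_(w in [set w | big Q (inf L + n.+1%:R^-1) w]) dset R (subcube Q w).
    apply/seteqP; split => x.
      move=> [w wb wx].
      have [n nb] : exists n : nat, inf L + n.+1%:R^-1 < `|avg f (subcube Q w)|.
        exists (Num.truncn (`|avg f (subcube Q w)| - inf L)^-1).
        rewrite -ltrBrDl invf_plt ?posrE ?subr_gt0//.
        exact: truncnS_gt.
      by exists n => //; exists w.
    move=> [n _ [w wb wx]]; exists w => //=.
    by apply: lt_trans wb; rewrite ltrDl invr_gt0.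
  apply: leb_bigcup_le.
  - by move=> n; exact: measurable_bigcup_dset.
  - move=> m n mn; apply/subsetPset => x [w wb wx]; exists w => //=.
    by apply: le_lt_trans wb; rewrite lerD2l lef_pV2 ?posrE// ler_nat.
  - by move=> n; have := Lu n; rewrite /L /= MQ_level_set rE.
set U := \bigcup_(w in _) _ => HU n.
have := hit_le_leb (c := big Q (inf L)) (Q := Q) (E := U) n [::] (measurable_bigcup_dset _ _).
move=> /(_ _)/le_trans H; rewrite -(ler_pM2l Q_gt0) -lee_fin.
apply: H; first by move=> w cw x wx; exists w.
apply: le_trans HU; apply: leb_le; last exact: subIsetl.
  by apply: measurableI; [exact: measurable_bigcup_dset|exact: measurable_dset].
exact: measurable_bigcup_dset.
Qed.

End LevelSets.

(** * The Haar shift *)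

Lemma sqr_sum_le (K : realFieldType) (I : finType) (z : I -> K) :
  (\sum_i z i) ^+ 2 <= #|I|%:R * \sum_i z i ^+ 2.
Proof.
have [i0 _|I0] := pickP I; last by rewrite !big_pred0// mulr0 expr0n.
have I0 : (0 < #|I|)%N by apply/card_gt0P; exists i0.
set N : K := #|I|%:R; set m := \sum_i z i.
have N0 : 0 < N by rewrite ltr0n.
(* Cauchy-Schwarz as the nonnegativity of the variance around the mean [N^-1 * m]. *)
have : 0 <= \sum_i (z i - N^-1 * m) ^+ 2 by apply: sumr_ge0 => i _; rewrite sqr_ge0.
rewrite (eq_bigr (fun i => z i ^+ 2 - (2 * (N^-1 * m)) * z i + (N^-1 * m) ^+ 2)); last first.
  by move=> i _; ring.
rewrite !big_split /= sumr_const sumrN -mulr_sumr -/m -[_ *+ #|I|]mulr_natl -/N.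
move=> H; rewrite -ler_pdivrMl// -subr_ge0; apply: le_trans H _.
rewrite le_eqVlt; apply/orP; left; apply/eqP; field; exact: lt0r_neq0.
Qed.

Lemma sqr_sum_bound (K : realFieldType) (I : finType) (z : I -> K) (k c : K) :
  #|I|%:R <= c -> 0 <= k -> (forall i, z i ^+ 2 <= k) -> (\sum_i z i) ^+ 2 <= c ^+ 2 * k.
Proof.
move=> Ic k0 zk; apply: le_trans (sqr_sum_le z) _.
have H : \sum_i z i ^+ 2 <= \sum_(i : I) k by apply: ler_sum.
rewrite sumr_const -[_ *+ #|I|]mulr_natl in H.
apply: (le_trans (ler_wpM2l (ler0n _ _) H)); rewrite mulrA -expr2 ler_wpM2r//.
by rewrite ler_pXn2r ?nnegrE ?ler0n// (le_trans _ Ic) ?ler0n.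
Qed.

Section Haar.
Variables (R : realType) (d : nat).
Local Notation mu := (@leb R d).
Local Notation O := (d.-tuple bool).
Local Notation b := (#|{: O}|%:R : R).
Local Notation J := 'I_(2 ^ d).-1.
Variable h : dcube d -> J -> d.-tuple R -> R.
Hypothesis hh : haar_basis h.
Implicit Types (Q P T S U : dcube d) (e : J).

Definition haar_val Q e (o : O) : R := h Q e (corner R (child Q o)).

Lemma haar_out Q e x : ~ dset R Q x -> h Q e x = 0.
Proof. by case: (hh Q e) => H _ _ _; exact: H. Qed.

Lemma haar_valE Q e o x : dset R (child Q o) x -> h Q e x = haar_val Q e o.
Proof.
case: (hh Q e) => _ H _ _ ox.
have [|c Hc] := H (child Q o).
  by split => // y; exact: dset_child_sub.
by rewrite /haar_val !Hc//; exact: corner_dset.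
Qed.

Let b_gt0 : 0 < b. Proof. by rewrite card_children ltr0n expn_gt0. Qed.

Lemma integrable_dset_cst Q (k : R) : mu.-integrable (dset R Q) (EFin \o cst k).
Proof.
apply/integrableP; split.
  by apply/measurable_realfun.measurable_EFinP; exact: measurable_cst.
have -> : (\int[mu]_(x in dset R Q) `|(EFin \o cst k) x|)%E =
    (\int[mu]_(x in dset R Q) cst `|k|%:E x)%E by exact: eq_integral.
rewrite integral_cst; last exact: measurable_dset.
by rewrite [X in (_ * X)%E]leb_dset -EFinM ltry.
Qed.

Lemma Rintegral_step_cst g Q (c : O -> R) :
  (forall x, ~ dset R Q x -> g x = 0) ->
  (forall o x, dset R (child Q o) x -> g x = c o) ->
  \int[mu]_x g x = b^-1 * volr R Q * \sum_o c o.
Proof.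
move=> g0 gc.
have := Rintegral_step (integrable_dset_cst Q 1) g0 gc.
have <- : \int[mu]_x (cst 1 x * g x) = \int[mu]_x g x.
  by apply: eq_Rintegral => x _; rewrite /= mul1r.
move=> ->; rewrite mulr_sumr; apply: eq_bigr => o _.
rewrite (Rintegral_cst mu); last exact: measurable_dset.
by rewrite mul1r [X in fine X]leb_dset /= volr_child mulrC.
Qed.

Lemma haar_mean Q e : \sum_o haar_val Q e o = 0.
Proof.
case: (hh Q e) => _ _ H _.
have := Rintegral_step_cst (@haar_out Q e) (@haar_valE Q e).
rewrite /Rintegral H => /esym/eqP; rewrite mulf_eq0 gt_eqF ?mulr_gt0 ?invr_gt0 ?volr_gt0//=.
by move/eqP.
Qed.

Lemma haar_norm Q e : \sum_o haar_val Q e o ^+ 2 = b / volr R Q.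
Proof.
case: (hh Q e) => _ _ _ /(_ e); rewrite eqxx => H.
have V0 := volr_gt0 R Q.
apply: (mulfI (x := b^-1 * volr R Q)); first by rewrite mulf_neq0 ?invr_neq0 ?gt_eqF.
rewrite -(@Rintegral_step_cst (fun x => h Q e x * h Q e x)).
- by rewrite /Rintegral H /=; field; rewrite !gt_eqF.
- by move=> x Qx; rewrite haar_out// mul0r.
- by move=> o x ox; rewrite (haar_valE _ ox) expr2.
Qed.

Lemma haar_sqr_le Q e x : h Q e x ^+ 2 <= b / volr R Q.
Proof.
have V0 := volr_gt0 R Q.
have [Qx|Qx] := pselect (dset R Q x); last first.
  by rewrite haar_out// expr0n divr_ge0// ltW.
have [ o ox] := dset_childP Qx; rewrite (haar_valE _ ox).
rewrite -(haar_norm Q e).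
by rewrite (bigD1 o)//= lerDl sumr_ge0// => i _; rewrite sqr_ge0.
Qed.

Variable f : d.-tuple R -> R.
Hypothesis fi : mu.-integrable setT (EFin \o f).

Definition child_var Q : R := b^-1 * (\sum_o avg f (child Q o) ^+ 2) - avg f Q ^+ 2.

(** The mean zero of the Haar function allows [avg f Q] to be subtracted, so that only oscillation
    remains. *)
Lemma pairing_haar Q e :
  pairing f (h Q e) = b^-1 * volr R Q * \sum_o haar_val Q e o * (avg f (child Q o) - avg f Q).
Proof.
rewrite /pairing -[LHS]/(Rintegral _ _ _).
rewrite (Rintegral_step (integrable_dset Q fi) (@haar_out Q e) (@haar_valE Q e)).
rewrite (eq_bigr (fun o => haar_val Q e o * avg f (child Q o) * (b^-1 * volr R Q))); last first.
  by move=> o _; rewrite Rintegral_avg volr_child; ring.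
rewrite -mulr_suml mulrC; congr (_ * _).
under [RHS]eq_bigr do rewrite mulrBr.
by rewrite sumrB -mulr_suml haar_mean mul0r subr0.
Qed.

Lemma child_varE Q : \sum_o (avg f (child Q o) - avg f Q) ^+ 2 = b * child_var Q.
Proof.
have aE : \sum_o avg f (child Q o) = b * avg f Q.
  by rewrite (avg_children (integrable_dset Q fi)) mulVKf// gt_eqF.
rewrite (eq_bigr (fun o => avg f (child Q o) ^+ 2 - (2 * avg f Q) * avg f (child Q o) + avg f Q ^+ 2)); last first.
  by move=> o _; ring.
rewrite !big_split /= sumr_const sumrN -mulr_sumr aE -[_ *+ #|_|]mulr_natl /child_var.
by field; rewrite gt_eqF.
Qed.

Lemma child_var_ge0 Q : 0 <= child_var Q.
Proof.
by rewrite -(pmulr_rge0 _ b_gt0) -child_varE sumr_ge0// => o _; rewrite sqr_ge0.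
Qed.

(** Bessel's inequality on the children: expand the square distance from the oscillation of [f] to
    [p] times the Haar values. *)
Lemma pairing_sqr_le Q e : pairing f (h Q e) ^+ 2 <= volr R Q * child_var Q.
Proof.
have V0 := volr_gt0 R Q.
set p := pairing _ _; pose y o := avg f (child Q o) - avg f Q.
have pE : b * p / volr R Q = \sum_o haar_val Q e o * y o.
  by rewrite /p pairing_haar; field; rewrite !gt_eqF.
have hE := haar_norm Q e.
have : 0 <= \sum_o (y o - p * haar_val Q e o) ^+ 2 by apply: sumr_ge0 => o _; rewrite sqr_ge0.
rewrite (eq_bigr (fun o => y o ^+ 2 - (2 * p) * (haar_val Q e o * y o) + p ^+ 2 * haar_val Q e o ^+ 2)); last first.
  by move=> o _; ring.
rewrite !big_split /= sumrN -!mulr_sumr child_varE hE -pE.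
rewrite (_ : _ + _ = b / volr R Q * (volr R Q * child_var Q - p ^+ 2)); last first.
  by field; rewrite gt_eqF.
by rewrite pmulr_rge0 ?divr_gt0// subr_ge0.
Qed.

Variables (s t : nat) (A : R).
Variable alpha : dcube d -> dcube d -> dcube d -> J -> J -> R.
Hypothesis A_ge0 : 0 <= A.
Hypothesis alphaA : forall Q T S e e', `|alpha Q T S e e'| <= A.

Definition shift_piece U (x : d.-tuple R) : R :=
  \sum_(v : t.-tuple O) \sum_(w : s.-tuple O) \sum_e \sum_e'
     alpha U (subcube U v) (subcube U w) e e' * pairing f (h (subcube U v) e)
       * h (subcube U w) e' x.

Lemma fsbig_Dl (F : dcube d -> R) U n :
  \sum_(T \in Dl R U n) F T = \sum_(v : n.-tuple O) F (subcube U v).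
Proof.
have -> : Dl R U n = (fun v : n.-tuple O => subcube U v) @` setT.
  apply/seteqP; split => T.
    move=> /DlE[w /eqP wn ->]; by exists (Tuple wn).
  by move=> [v _ <-]; apply/DlE; exists (v : seq O) => //; rewrite size_tuple.
rewrite fsbig_image; last by move=> v w _ _ /subcube_inj/val_inj.
rewrite (fsbigE (index_enum _)) ?index_enum_uniq//.
  by apply: eq_bigl => v; rewrite in_setT.
by move=> v _; rewrite mem_index_enum.
Qed.

Lemma shift_truncE l m x :
  shift_trunc s t h alpha f l m x =
  \sum_(k \in [set k : int | l <= k <= m]) shift_piece (cube_at k x) x.
Proof.
apply: eq_fsbigr => k _.
have -> : [set Q : dcube d | Q.1 = k /\ dset R Q x] = [set cube_at k x].
  apply/seteqP; split => Q; first by move=> [<-] /dsetE.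
  by move=> ->; split => //; exact: cube_atP.
by rewrite fsbig_set1 fsbig_Dl; apply: eq_bigr => v _; rewrite fsbig_Dl.
Qed.

(** The functions [h S] have [S] lying [s] levels below [U] and are constant on the children of
    [S]. *)
Lemma shift_piece_cst U v x y : size v = s.+1 ->
  dset R (subcube U v) x -> dset R (subcube U v) y -> shift_piece U x = shift_piece U y.
Proof.
case: v => // o v [vs] vx vy.
apply: eq_bigr => v1 _; apply: eq_bigr => w _; apply: eq_bigr => e _.
apply: eq_bigr => e' _; congr (_ * _).
have [wv|wv] := pselect (w = v :> seq O); first by rewrite wv (haar_valE _ vx) (haar_valE _ vy).
have H z : dset R (subcube U (o :: v)) z -> ~ dset R (subcube U w) z.
  by move=> /dset_child_sub vz wz; apply: wv; apply: subcube_eq wz vz; rewrite size_tuple.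
by rewrite !haar_out//; exact: H.
Qed.

(** Only the Haar functions of [subcube U v] itself survive there, and they have mean zero: the
    pieces are martingale differences. *)
Lemma shift_piece_mean U v : size v = s ->
  \sum_o shift_piece U (corner R (subcube U (o :: v))) = 0.
Proof.
move=> vs; rewrite exchange_big big1// => v1 _; rewrite exchange_big big1// => w _.
rewrite exchange_big big1// => e _; rewrite exchange_big big1// => e' _.
rewrite -mulr_sumr; apply/eqP; rewrite mulf_eq0; apply/orP; right; apply/eqP.
have [->|wv] := pselect (w = v :> seq O); first exact: haar_mean.
rewrite big1// => o _; apply: haar_out => wz; apply: wv.
apply: subcube_eq wz (dset_child_sub (corner_dset R _)); by rewrite size_tuple.
Qed.

(** Exponent count: [t] from Cauchy-Schwarz over [v], [2 * s] from the sum over [w], 4 from the two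
    Haar indices, and [s + 1] from the sup norm of [h S]. The volume of [U] cancels. *)
Lemma shift_piece_sqr_le U x :
  shift_piece U x ^+ 2 <=
  b ^+ (t + 3 * s + 5)%N * A ^+ 2 *
    (b^-1 ^+ t * \sum_(v : t.-tuple O) child_var (subcube U v)).
Proof.
have V0 := volr_gt0 R U.
have cardJ : #|J|%:R <= b by rewrite card_ord card_children ler_nat leq_pred.
have cards n : #|{: n.-tuple O}|%:R = b ^+ n by rewrite card_tuple natrX.
have vs n (v : n.-tuple O) : volr R (subcube U v) = b^-1 ^+ n * volr R U.
  by rewrite volr_subcube size_tuple.
pose k (v : t.-tuple O) := A ^+ 2 * (b^-1 ^+ t * volr R U * child_var (subcube U v)) *
  (b / (b^-1 ^+ s * volr R U)).
have k0 v : 0 <= k v.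
  rewrite /k -(vs t v) -(vs s [tuple of nseq s [tuple false | i < d]]).
  apply: mulr_ge0; last by rewrite divr_ge0 ?(ltW b_gt0)// ltW// volr_gt0.
  by rewrite !mulr_ge0 ?sqr_ge0 ?child_var_ge0// ltW// volr_gt0.
have H (v : t.-tuple O) : (\sum_(w : s.-tuple O) \sum_e \sum_e'
     alpha U (subcube U v) (subcube U w) e e' * pairing f (h (subcube U v) e)
       * h (subcube U w) e' x) ^+ 2 <= (b ^+ s) ^+ 2 * (b ^+ 2 * (b ^+ 2 * k v)).
  have b2 y : 0 <= y -> 0 <= b ^+ 2 * y by move=> ?; rewrite mulr_ge0 ?sqr_ge0.
  apply: sqr_sum_bound; rewrite ?cards ?b2 ?k0// => w.
  apply: sqr_sum_bound; rewrite ?b2 ?k0// => e.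
  apply: sqr_sum_bound; rewrite ?k0// => e'.
  rewrite 2!exprMn /k -(vs t v) -(vs s w).
  refine (ler_pM _ (sqr_ge0 _) _ (haar_sqr_le _ _ _)); first by rewrite mulr_ge0 ?sqr_ge0.
  refine (ler_pM (sqr_ge0 _) (sqr_ge0 _) _ (pairing_sqr_le _ _)).
  by rewrite -real_normK ?num_real// ler_pXn2r ?nnegrE.
apply: (le_trans (sqr_sum_le _)); rewrite cards.
apply: (le_trans (ler_wpM2l _ (ler_sum _ (fun v _ => H v)))); first by rewrite exprn_ge0// ltW.
rewrite le_eqVlt; apply/orP; left; apply/eqP.
have -> : b ^+ (t + 3 * s + 5)%N = b ^+ t * (b ^+ s) ^+ 3 * b ^+ 5.
  by rewrite 2!exprD mulnC exprM.
rewrite !mulr_sumr; apply: eq_bigr => v _; rewrite /k !exprVn.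
field; rewrite ?expf_neq0 ?(gt_eqF b_gt0) ?(gt_eqF V0) ?(gt_eqF (dside_gt0 R U))//.
Qed.

End Haar.

(** * The sparse family *)

(* The cubes having the origin as a vertex. *)
Definition corner_cube {d : nat} (P : dcube d) : Prop :=
  forall i, tnth P.2 i = 0 \/ tnth P.2 i = -1.

Definition seed {d : nat} (P : dcube d) : Prop :=
  corner_cube P /\ exists m : int, P.1 = 2 * m.

Section Selection.
Variables (R : realType) (d : nat).
Hypothesis d_gt0 : (0 < d)%N.
Local Notation O := (d.-tuple bool).
Implicit Types (Q P : dcube d) (w v u : seq O).

Definition corner_child Q : dcube d := child Q [tuple tnth Q.2 i == -1 | i < d].

Lemma corner_child_eq Q o : corner_cube (child Q o) ->
  corner_cube Q /\ child Q o = corner_child Q.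
Proof.
move=> H; have E i : (tnth Q.2 i = 0 /\ tnth o i = false) \/ (tnth Q.2 i = -1 /\ tnth o i = true).
  by have := H i; rewrite tnth_mktuple; case: (tnth o i) => /= ?; lia.
split; first by move=> i; case: (E i) => -[? _]; [left|right].
congr child; apply: eq_from_tnth => i; rewrite tnth_mktuple.
by case: (E i) => -[-> ->].
Qed.

Lemma corner_subcube Q w : corner_cube (subcube Q w) -> corner_cube Q.
Proof. by elim: w => // o w IHw /corner_child_eq[/IHw]. Qed.

Lemma seed_exists (x : d.-tuple R) (l : int) :
  exists Q, [/\ seed Q, dset R Q x & Q.1 <= l].
Proof.
(* With [j] above [|l|] and all coordinates of [x], the cube of side [2 ^ (2 * j)] has indices 0 or
   -1; the factor 2 makes the generation even. *)
pose j := (absz l + \sum_(i < d) (Num.truncn `|tnth x i|).+1)%N.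
have lj : - j%:Z <= l by rewrite /j; lia.
exists (cube_at (- (2 * j)%N%:Z) x); split; last 2 first.
- exact: cube_atP.
- by rewrite /=; lia.
split; last by exists (- j%:Z); rewrite /=; lia.
move=> i; rewrite tnth_mktuple.
have xj : `|tnth x i| < 2 ^ (2 * j)%N%:Z.
  have H : ((Num.truncn `|tnth x i|).+1 <= 2 ^ (2 * j))%N.
    apply: leq_trans (ltnW (ltn_expl _ (leqnn 2))).
    by rewrite /j (bigD1 i)//=; set a := Num.truncn _; lia.
  apply: (lt_le_trans (truncnS_gt _)).
  by rewrite -exprnP -natrX ler_nat; exact: H.
have k0 : 0 < (2 : R) ^ (2 * j)%N%:Z by rewrite exprz_gt0.
have : -1 < tnth x i * 2 ^ (- (2 * j)%N%:Z) < 1.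
  rewrite -invr_expz -ltr_norml normrM normfV (gtr0_norm k0).
  by rewrite ltr_pdivrMr// mul1r.
set y := tnth x i * _ => /andP[y1 y2].
have [y0|y0] := leP 0 y; [left|right]; apply: floor_def; apply/andP; split.
- by rewrite y0.
- by rewrite add0r.
- exact: ltW.
- by rewrite addNr.
Qed.

Variable bad : dcube d -> seq O -> bool.

Definition halt Q w : Prop := bad Q w \/ seed (subcube Q w).

(** Nonempty words only: [Q] is not its own successor, and the minimality concerns the cubes
    strictly between. *)
Definition first_halt Q w : Prop :=
  [/\ w <> [::], halt Q w &
      forall v u, w = v ++ u -> v <> [::] -> u <> [::] -> ~ halt Q u].

Fixpoint selected (n : nat) (P : dcube d) : Prop :=
  if n is n'.+1 then
    exists Q w, [/\ selected n' Q, first_halt Q w & P = subcube Q w]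
  else seed P.

Definition selection : set (dcube d) := [set P | exists n, selected n P].

(* When [Q] lies strictly between [P] and the selected cube [Q1] that [P] was obtained
   from, the induction is applied to [Q] below [Q1]: hence the induction on [n + m]. *)
Lemma selected_halt n m P Q w : selected n P -> selected m Q ->
  P = subcube Q w -> w <> [::] ->
  exists v u, [/\ w = v ++ u, u <> [::] & halt Q u].
Proof.
have [N leN] := ubnP (n + m).
elim: N n m P Q w leN => // N IHN [|n] m P Q w leN.
  move=> sP _ PE w0; exists [::], w; split => //; right; by rewrite -PE.
move=> [Q1 [w1 [sQ1 [w10 hw1 minw1] PE1]]] sQ PE w0.
have Px : dset R P (corner R P) := corner_dset R P.
have Qx : dset R Q (corner R P) by apply: (@subcube_sub R d Q w); rewrite -PE.
have Q1x : dset R Q1 (corner R P) by apply: (@subcube_sub R d Q1 w1); rewrite -PE1.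
have [le1|lt1] := leP Q.1 Q1.1.
  have E : Q1.1 = Q.1 + `|Q1.1 - Q.1|%N%:Z by lia.
  have [w' _ Q1E] := dset_meet Q1x Qx E.
  have wE : w = w1 ++ w' by apply: (@subcube_inj d Q); rewrite subcube_cat -Q1E -PE1.
  have [w'0|w'0] := pselect (w' = [::]).
    exists [::], w; split => //.
    by move: Q1E; rewrite w'0 /= => <-; rewrite wE w'0 cats0.
  have [v [u [w'E u0 hu]]] := IHN n m Q1 Q w' ltac:(by lia) sQ1 sQ Q1E w'0.
  by exists (w1 ++ v), u; split => //; rewrite wE w'E catA.
have E : Q.1 = Q1.1 + `|Q.1 - Q1.1|%N%:Z by lia.
have [w' w's QE] := dset_meet Qx Q1x E.
have w'0 : w' <> [::] by move=> w'0; move: w's; rewrite w'0 /=; lia.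
have w1E : w1 = w ++ w' by apply: (@subcube_inj d Q1); rewrite subcube_cat -QE -PE -PE1.
have [v [u [w'E u0 hu]]] := IHN m n Q Q1 w' ltac:(by lia) sQ sQ1 QE w'0.
exfalso; apply: (minw1 (w ++ v) u) hu => //; first by rewrite w1E w'E catA.
by case: (w) w0.
Qed.

Hypothesis bad_child : forall Q o, ~~ bad Q [:: o].

(* A selected corner cube of odd generation would have a seed as a child, which for
   [d = 1] already fills half of it. *)
Lemma selected_corner n P : selected n P -> corner_cube P -> seed P.
Proof.
elim: n P => // n IHn P [Q [w [sQ [w0 hw minw] PE]]] cP.
have cQ : corner_cube Q by apply: (@corner_subcube Q w); rewrite -PE.
have [_ [m mE]] := IHn Q sQ cQ.
split => //.
case/lastP: w w0 hw minw PE => // w o1 _; case/lastP: w => [|w o2].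
  move=> [|sP _ PE]; first by move/negP: (bad_child Q o1).
  by have [_] := sP; rewrite -PE.
case/lastP: w => [|w o3] _ minw PE.
  by exists (m + 1); rewrite PE /= mE; lia.
exfalso; apply: (minw (rcons w o3) [:: o2; o1]) => //.
- by rewrite -!cats1 -!catA.
- by case: (w).
right; split.
  apply: (@corner_subcube _ (rcons w o3)); rewrite -subcube_cat.
  by move: cP; rewrite PE -!cats1 -!catA.
by exists (m + 1); rewrite /= mE; lia.
Qed.

(** [Q] is then itself a seed, so by parity the seed inside it lies at least two generations deeper,
    in the one grandchild of [Q] with a vertex at the origin. *)
Lemma selection_seed_sub Q u : selection Q -> u <> [::] -> seed (subcube Q u) ->
  dset R (subcube Q u) `<=` dset R (corner_child (corner_child Q)).
Proof.
move=> [n sQ] u0 [cu [k kE]].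
have [_ [m mE]] := selected_corner sQ (corner_subcube cu).
case/lastP: u u0 cu kE => // u o1 _; case/lastP: u => [|u o2] cu kE.
  by move: kE; rewrite subcube_gen /= mE; lia.
move: cu; rewrite -!cats1 !subcube_cat => /corner_subcube cu.
have /corner_child_eq[_ E1] : corner_cube (child Q o1) by case: (corner_child_eq cu).
have [_ E2] := corner_child_eq cu.
have -> : corner_child (corner_child Q) = child (child Q o1) o2 by rewrite -E1; exact/esym.
by move=> x /subcube_sub.
Qed.

Lemma first_halt_dec Q w :
  (forall v u, w = v ++ u -> u <> [::] -> ~ halt Q u) \/
  exists v u, w = v ++ u /\ first_halt Q u.
Proof.
elim: w => [|o w [IHw|[v [u [wE hu]]]]].
- by left=> -[|//] u /= <-.
- have [ho|ho] := pselect (halt Q (o :: w)).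
    right; exists [::], (o :: w); split => //; split => // -[|o' v] u wE v0 u0; first by case: v0.
    by case: wE => _ wE; exact: IHw wE u0.
  by left=> -[|o' v] u /= => [<-//|[_]]; exact: IHw.
- by right; exists (o :: v), u; rewrite wE.
Qed.

Lemma first_halt_selection Q w : selection Q -> first_halt Q w -> selection (subcube Q w).
Proof. by move=> [n sQ] hw; exists n.+1, Q, w. Qed.

Hypothesis bad_leb : forall Q,
  (leb d (\bigcup_(w in [set w | bad Q w]) dset R (subcube Q w)) <= (volr R Q * 4^-1)%:E)%E.

Lemma leb_leU (X Y Z : set (d.-tuple R)) : measurable X -> measurable Y -> measurable Z ->
  X `<=` Y `|` Z -> (leb d X <= leb d Y + leb d Z)%E.
Proof.
move=> mX mY mZ XYZ; apply: (@le_trans _ _ (leb d (Y `|` Z))).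
  by apply: leb_le => //; exact: measurableU.
exact: (measureU2 (@leb R d)).
Qed.

(** Every selected cube strictly inside [Q], whatever chain produced it, lies in a bad cube of [Q]
    or in the grandchild at the origin; each of these two parts fills at most a quarter. *)
Lemma selection_sparse : sparse R selection.
Proof.
move=> Q SQ; set U := \bigcup_(P in _) _.
pose B := \bigcup_(w in [set w | bad Q w]) dset R (subcube Q w).
pose P2 := corner_child (corner_child Q).
have mU : measurable U by exact: measurable_bigcup_dset.
have mB : measurable B by exact: measurable_bigcup_dset.
have mQ : measurable (dset R Q) by exact: measurable_dset.
have mP2 : measurable (dset R P2) by exact: measurable_dset.
have UB : U `<=` B `|` dset R P2.
  move=> x [P [[n sP] [PQ QP]] Px]; have [m sQ] := SQ.
  have [w PE] : exists w, P = subcube Q w by apply/(DsubE R d_gt0).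
  have w0 : w <> [::] by move=> w0; apply: QP; rewrite PE w0.
  have [v [u [wE u0 [bu|su]]]] := selected_halt sP sQ PE w0.
    by left; exists u => //; move: Px; rewrite PE wE subcube_cat => /subcube_sub.
  right; apply: (selection_seed_sub SQ u0 su).
  by move: Px; rewrite PE wE subcube_cat => /subcube_sub.
have V0 := volr_gt0 R Q.
have b2 : 2 <= #|{: O}|%:R :> R.
  by rewrite card_children ler_nat -[X in (X <= _)%N](expn1 2) leq_exp2l.
have P2le : volr R P2 <= 4^-1 * volr R Q.
  rewrite /P2 /corner_child !volr_child mulrA ler_wpM2r ?(ltW V0)// -invfM.
  rewrite lef_pV2 ?posrE//; [nra|nra].
have : (leb d (dset R Q) <= leb d (dset R Q `\` U) + (leb d B + leb d (dset R P2)))%E.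
  apply: (@le_trans _ _ (leb d (dset R Q `\` U) + leb d U)%E).
    apply: leb_leU => //; first exact: measurableD.
    by move=> x Qx; have [Ux|Ux] := pselect (U x); [right|left].
  by rewrite leeD2l//; exact: leb_leU.
have : (leb d B <= (volr R Q * 4^-1)%:E)%E := bad_leb Q.
rewrite !leb_dset volE -/(volr R Q).
case: (leb d B) => [z||]//= ; case: (leb d (dset R Q `\` U)) => [y||]//=; rewrite ?leey//.
- by rewrite -!EFinD -EFinM !lee_fin; lra.
Qed.

End Selection.

(** * Choice of constants, stopping cubes and pointwise domination *)

Section Domination.
Variables (R : realType) (d s t : nat).
Hypothesis d_gt0 : (0 < d)%N.
Local Notation mu := (@leb R d).
Local Notation O := (d.-tuple bool).
Local Notation b := (#|{: O}|%:R : R).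
Local Notation J := 'I_(2 ^ d).-1.
Implicit Types (Q P U : dcube d) (w v u : seq O).

Definition bound_const : R := b ^+ (t + 3 * s + 5)%N.
Definition stop_const : R := 8 * b * bound_const.
Definition path_const : R := stop_const + s.+1%:R * bound_const.
Definition level_const : R := (8 * b ^+ t.+2)^-1.

Let b_ge1 : 1 <= b. Proof. by rewrite card_children ler1n expn_gt0. Qed.
Let b_gt0 : 0 < b. Proof. exact: lt_le_trans b_ge1. Qed.

Lemma bound_const_ge1 : 1 <= bound_const.
Proof. by rewrite exprn_ege1. Qed.

Lemma stop_const_gt0 : 0 < stop_const.
Proof. by rewrite !mulr_gt0// (lt_le_trans _ bound_const_ge1). Qed.

Lemma path_const_gt0 : 0 < path_const.
Proof.
by rewrite ltr_pwDl ?stop_const_gt0// mulr_ge0// (le_trans _ bound_const_ge1).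
Qed.

Lemma level_const_itv : 0 < level_const < 1.
Proof.
have bt : 1 <= b ^+ t.+2 by rewrite exprn_ege1.
by rewrite invr_gt0 invf_lt1; lra.
Qed.

(** The constants make each kind of stopping cube contribute at most [(8 * b)^-1]. The factor [b],
    beyond what sparseness needs, keeps the children of [Q] from being bad. *)
Lemma stop_fraction : b ^+ t.+1 * level_const + bound_const / stop_const ^+ 2 <= (4 * b)^-1.
Proof.
have c1 := bound_const_ge1.
have b0 := b_gt0; have b1 := b_ge1.
have -> : b ^+ t.+1 * level_const = (8 * b)^-1.
  by rewrite /level_const [b ^+ t.+2]exprS; field; rewrite ?expf_neq0 ?gt_eqF.
have : bound_const / stop_const ^+ 2 <= (8 * b)^-1.
  rewrite ler_pdivrMr ?exprn_gt0 ?stop_const_gt0// /stop_const.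
  rewrite (_ : _^-1 * _ = 8 * b * bound_const ^+ 2); last by field; rewrite gt_eqF.
  by rewrite expr2; nra.
have -> : (4 * b)^-1 = (8 * b)^-1 + (8 * b)^-1 by field; rewrite gt_eqF.
lra.
Qed.

Variable h : dcube d -> J -> d.-tuple R -> R.
Hypothesis hh : haar_basis h.
Variable f : d.-tuple R -> R.
Hypothesis fi : mu.-integrable setT (EFin \o f).
Variable A : R.
Variable alpha : dcube d -> dcube d -> dcube d -> J -> J -> R.
Hypothesis A_ge0 : 0 <= A.
Hypothesis alphaA : forall Q T S e e', `|alpha Q T S e e'| <= A.

Local Notation piece := (shift_piece h f s t alpha).

(* [Pq] is finite here, see [levelP]. *)
Definition level Q : R := fine (Pq level_const Q (MQ f Q)).
Definition mean_at Q w : R := avg f (subcube Q w).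
(** The piece coming from the ancestor [s.+1] levels above, constant on [subcube Q w] and hence read
    at its corner. For shorter words it is a dummy value. *)
Definition shift_at Q w : R := piece (subcube Q (drop s.+1 w)) (corner R (subcube Q w)).
Definition bad_cube Q : pred (seq O) :=
  stop s t (mean_at Q) (shift_at Q) (level Q) (stop_const * A * level Q).

Lemma levelP Q : [/\ 0 <= level Q, Pq level_const Q (MQ f Q) = (level Q)%:E &
  forall n, hit (fun w => level Q < `|mean_at Q w|) n [::] <= level_const].
Proof.
have [lam [lam0 PE H]] := Pq_attained d_gt0 fi Q level_const_itv.
by rewrite /level PE.
Qed.

Lemma shift_atE Q w x : (s < size w)%N -> dset R (subcube Q w) x ->
  shift_at Q w = piece (cube_at (Q.1 + (size w - s.+1)%N%:Z) x) x.
Proof.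
move=> sw wx; rewrite /shift_at.
have E : subcube Q w = subcube (subcube Q (drop s.+1 w)) (take s.+1 w).
  by rewrite -subcube_cat cat_take_drop.
have -> : cube_at (Q.1 + (size w - s.+1)%N%:Z) x = subcube Q (drop s.+1 w).
  rewrite -size_drop -subcube_gen; apply/esym/dsetE.
  by apply: (@subcube_sub _ _ _ (take s.+1 w)); rewrite -E.
apply: (shift_piece_cst hh f t alpha (v := take s.+1 w)) => //; rewrite ?size_takel// -?E//.
exact: corner_dset.
Qed.

Lemma shift_at_mean Q w : (s <= size w)%N -> child_mean (shift_at Q) w = 0.
Proof.
move=> sw; rewrite /child_mean.
rewrite (_ : \sum_o _ = 0) ?mulr0//.
rewrite -[RHS](shift_piece_mean hh f t alpha (subcube Q (drop s w)) (size_takel sw)).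
apply: eq_bigr => o _; rewrite /shift_at.
by rewrite -[in RHS]subcube_cat cat_cons cat_take_drop.
Qed.

Let o0 : O := [tuple false | i < d].

Lemma shift_at_bound Q v u : size v = s.+1 ->
  shift_at Q (v ++ u) ^+ 2 <= bound_const * A ^+ 2 * iter t child_mean
    (fun w => child_mean (fun w => mean_at Q w ^+ 2) w - mean_at Q w ^+ 2) u.
Proof.
move=> vs; rewrite /shift_at -vs drop_size_cat// iter_mean_words.
apply: le_trans (shift_piece_sqr_le hh fi s t A_ge0 alphaA _ _) _.
rewrite le_eqVlt; apply/orP; left; apply/eqP; congr (_ * (_ * _)).
by apply: eq_bigr => w _; rewrite /child_var -!subcube_cat.
Qed.

Lemma hit_bad_cube Q n : hit (bad_cube Q) n [::] <= (4 * b)^-1.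
Proof.
have [lam0 _ hl] := levelP Q.
apply: le_trans stop_fraction; apply: hit_stop => //.
- exact: bound_const_ge1.
- by move=> w; exact: avg_child_mean.
- exact: shift_at_mean.
- exact: shift_at_bound.
- exact: stop_const_gt0.
Qed.

(** A bad cube among [Q] and its children would fill at least [b^-1] of [Q], above the allowed
    [(4 * b)^-1]. *)
Lemma bad_cube_short Q w : (size w <= 1)%N -> ~~ bad_cube Q w.
Proof.
move=> w1; apply/negP => bw; have := hit_bad_cube Q 1; apply/negP; rewrite -ltNge.
have := @hit_word R O o0 (bad_cube Q) 1 w [::]; rewrite cats0 => /(_ w1 bw).
apply: lt_le_trans.
have b1 := b_ge1; apply: (@lt_le_trans _ _ b^-1).
  by rewrite ltf_pV2 ?posrE ?mulr_gt0//; lra.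
case: (w) w1 => [_|o [|//] _] /=; first by rewrite expr0 invf_le1.
by rewrite expr1.
Qed.

Lemma bad_cube_leb Q :
  (leb d (\bigcup_(w in [set w | bad_cube Q w]) dset R (subcube Q w)) <= (volr R Q * 4^-1)%:E)%E.
Proof.
apply: (le_trans (leb_hit_union Q (hit_bad_cube Q))).
rewrite lee_fin ler_wpM2l ?(ltW (volr_gt0 _ _))// lef_pV2 ?posrE ?mulr_gt0//.
have := b_ge1; lra.
Qed.

Definition scale_sum (x : d.-tuple R) (l : int) (n : nat) : R :=
  \sum_(i < n) piece (cube_at (l + i%:Z) x) x.

Lemma scale_sumD x l m n : scale_sum x l (m + n) = scale_sum x l m + scale_sum x (l + m%:Z) n.
Proof.
rewrite /scale_sum big_split_ord /=; congr (_ + _); apply: eq_bigr => i _.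
by rewrite PoszD addrA.
Qed.

Lemma scale_sum_path Q x w : dset R (subcube Q w) x -> alive (bad_cube Q) w ->
  `|scale_sum x Q.1 (size w).+1| <= path_const * A * level Q.
Proof.
move=> wx aw; have [lam0 _ _] := levelP Q.
(* The piece of [subcube Q w] is visible only [s.+1] levels further down, so the path is prolonged
   to there. *)
have [v vs vwx] := dset_subcubeP s.+1 wx; rewrite -subcube_cat in vwx.
have := path_bound o0 lam0 A_ge0 bound_const_ge1 (@shift_at_bound Q)
  (k := stop_const) aw (eq_leq vs).
have -> : (size (v ++ w) - s = (size w).+1)%N by rewrite size_cat vs; lia.
rewrite vs; congr (`|_| <= _).
(* The path sum starts from the finest scale, [scale_sum] from the coarsest. *)
rewrite /scale_sum [RHS](reindex_inj rev_ord_inj) /=; apply: eq_bigr => i _.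
have iw := ltn_ord i.
rewrite (@shift_atE _ _ x); last 2 first.
- by rewrite size_drop size_cat vs; lia.
- by move: vwx; rewrite -{1}(cat_take_drop i (v ++ w)) subcube_cat => /subcube_sub.
by congr (piece (cube_at (_ + _%:Z) _) _); rewrite size_drop size_cat vs; lia.
Qed.

Local Notation selection := (selection bad_cube).

(** Induction on the number of scales: up to the parent of the first halting cube the sum costs one
    [level Q], and the argument restarts at the halting cube. Generations increase strictly, so no
    cube is repeated. *)
Lemma scale_sum_le Q x n : selection Q -> dset R Q x ->
  exists Ps : seq (dcube d), [/\ uniq Ps,
    forall P, P \in Ps -> [/\ selection P, dset R P x & Q.1 <= P.1] &
    `|scale_sum x Q.1 n| <= path_const * A * \sum_(P <- Ps) level P].
Proof.
have [N leN] := ubnP n; elim: N n Q leN => // N IHN [|m] Q leN SQ Qx.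
  by exists [::]; split => //; rewrite /scale_sum big_ord0 normr0 big_nil mulr0.
(* A sum of [m.+1] scales ends at the cube [m] levels below [Q]. *)
have [w ws wx] := dset_subcubeP m Qx.
have [noh|[v [u [wE hu]]]] := first_halt_dec bad_cube Q w.
  exists [:: Q]; split => //.
    by move=> P; rewrite inE => /eqP ->.
  rewrite big_seq1 -ws; apply: scale_sum_path => //.
  apply/aliveP => v u wE; have [->|u0] := pselect (u = [::]); first exact: bad_cube_short.
  by apply/negP => bu; apply: (noh v u wE u0); left.
have SP := first_halt_selection SQ hu.
have Px : dset R (subcube Q u) x by move: wx; rewrite wE subcube_cat => /subcube_sub.
case: u hu wE SP Px => [[]//|o u] [_ _ minu] wE SP Px.
have um : (size u < m)%N by rewrite -ws wE size_cat /=; lia.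
have [Ps [uPs HPs lePs]] := IHN (m - size u)%N (subcube Q (o :: u)) ltac:(by lia) SP Px.
rewrite subcube_gen /= in HPs lePs.
exists (Q :: Ps); split.
- rewrite /= uPs andbT; apply/negP => /HPs[_ _]; lia.
- move=> P; rewrite inE => /orP[/eqP ->//|/HPs[? ? ?]]; split => //; lia.
rewrite big_cons mulrDr (_ : m.+1 = (size u).+1 + (m - size u))%N; last by lia.
rewrite scale_sumD; apply: (le_trans (ler_normD _ _)); apply: lerD => //.
apply: scale_sum_path; first exact: dset_child_sub Px.
apply/aliveP => v' u' uE; have [->|u0] := pselect (u' = [::]); first exact: bad_cube_short.
apply/negP => bu; apply: (minu (o :: v') u') => //; first by rewrite uE.
by left.
Qed.

Local Notation bound x :=
  (\esum_(Q in [set Q | selection Q /\ dset R Q x]) Pq level_const Q (MQ f Q))%E.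

Lemma sum_level_le x (Ps : seq (dcube d)) : uniq Ps ->
  (forall P, P \in Ps -> selection P /\ dset R P x) ->
  ((\sum_(P <- Ps) level P)%:E <= bound x)%E.
Proof.
move=> uPs HPs; apply: esum_ge; exists [set` Ps].
  by split; [exact: finite_seq|exact: HPs].
rewrite -fsbig_seq// -sumEFin; apply: lee_sum => P _.
by have [_ -> _] := levelP P.
Qed.

Lemma shift_trunc_scale_sum l m x : l <= m ->
  shift_trunc s t h alpha f l m x = scale_sum x l (absz (m - l)).+1.
Proof.
move=> lm; rewrite shift_truncE /scale_sum.
rewrite (fsbig_ord _ _ (fun i : nat => piece (cube_at (l + i%:Z) x) x)).
have -> : [set k : int | l <= k <= m] = (fun i : nat => l + i%:Z) @` `I_(absz (m - l)).+1.
  apply/seteqP; split => k /=; last by move=> [i ? <-]; lia.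
  by move=> lkm; exists (absz (k - l)); lia.
by rewrite fsbig_image// => i j _ _ /addrI[].
Qed.

Lemma shift_max_le x :
  (shift_max s t h alpha f x <= (2 * path_const * A)%:E * bound x)%E.
Proof.
apply: ge_ereal_sup => _ [l [m [lm ->]]].
have [Q [sQ Qx Ql]] := seed_exists d_gt0 x l.
have SQ : selection Q by exists 0%N.
rewrite (shift_trunc_scale_sum x (ltW lm)); set n := _.+1; pose k := absz (l - Q.1).
have lE : l = Q.1 + k%:Z by rewrite /k; lia.
have [Ps1 [u1 H1 le1]] := scale_sum_le k SQ Qx.
have [Ps2 [u2 H2 le2]] := scale_sum_le (k + n) SQ Qx.
have c0 := path_const_gt0.
set X1 := \sum_(P <- Ps1) level P in le1; set X2 := \sum_(P <- Ps2) level P in le2.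
have X1le : (X1%:E <= bound x)%E by apply: sum_level_le => // P /H1[].
have X2le : (X2%:E <= bound x)%E by apply: sum_level_le => // P /H2[].
have : ((2 * path_const * A)%:E * (Num.max X1 X2)%:E <= (2 * path_const * A)%:E * bound x)%E.
  apply: lee_wpmul2l; first by rewrite lee_fin !mulr_ge0// ltW.
  by rewrite EFin_max ge_max X1le.
apply: le_trans; rewrite -EFinM lee_fin.
(* The truncation is a difference of two sums starting at the seed, each dominated by the same
   sparse sum: this is the factor 2. *)
have -> : scale_sum x l n = scale_sum x Q.1 (k + n) - scale_sum x Q.1 k.
  by rewrite scale_sumD -lE addrAC subrr add0r.
apply: (le_trans (ler_normB _ _)); apply: (le_trans (lerD le2 le1)).
have cA : 0 <= path_const * A by rewrite mulr_ge0// ltW.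
rewrite (_ : 2 * path_const * A * Num.max X1 X2 =
  path_const * A * Num.max X1 X2 + path_const * A * Num.max X1 X2); last by ring.
by rewrite lerD// ler_wpM2l// le_max lexx ?orbT.
Qed.

End Domination.

Theorem theorem2p7 (R : realType) (d s t : nat) :
  (0 < d)%N ->
  exists C : R, 0 < C /\
  forall (h : dcube d -> 'I_(2 ^ d).-1 -> d.-tuple R -> R),
    haar_basis h ->
  forall (A : R)
    (alpha : dcube d -> dcube d -> dcube d -> 'I_(2 ^ d).-1 -> 'I_(2 ^ d).-1 -> R),
    0 <= A ->
    (forall Q T S e e', `| alpha Q T S e e' | <= A) ->
  forall f : d.-tuple R -> R,
    (@leb R d).-integrable setT (EFin \o f) ->
  exists r : R, 0 < r /\
  exists S : set (dcube d), sparse R S /\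
  forall x : d.-tuple R,
    (shift_max s t h alpha f x <=
      (C * A)%:E * \esum_(Q in [set Q | S Q /\ dset R Q x]) Pq r Q (MQ f Q))%E.
Proof.
(* The constant depends on [d], [s] and [t] only, and the quantile parameter [r] chosen below on [d]
   and [t] only. *)
move=> d_gt0; exists (2 * path_const R d s t).
split; first by rewrite mulr_gt0 ?path_const_gt0.
move=> h hh A alpha A_ge0 alphaA f fi.
exists (level_const R d t); split.
  by have /andP[] := level_const_itv R d t.
exists (selection (bad_cube s t h f A alpha)); split.
  apply: (selection_sparse d_gt0) => Q.
    by move=> o; apply: bad_cube_short.
  exact: bad_cube_leb.
move=> x; exact: shift_max_le.
Qed.
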